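(* Let $G$ be a maximal nontraceable graph of order $n$. Then $e(G)\ge 10$ if $n=8$, $e(G)\ge 12$ if $n=9$, and $e(G)\ge \tfrac{3n-2}{2}$ if $n\ge 10$.
   Context: Graphs are simple and finite; $e(G)$ is the number of edges. A graph is traceable if it has a hamiltonian path. A graph $G$ is maximal nontraceable if $G$ is not traceable but $G+e$ is traceable for every pair of nonadjacent vertices joined by a new edge $e$. *)

(* Defs.v *)
(* A finite simple graph is a symmetric irreflexive relation on a
   finType of vertices. *)
From mathcomp Require Import all_boot all_order all_algebra.

Set Implicit Arguments.
Unset Strict Implicit.
Unset Printing Implicit Defensive.

Definition simple_graph (T : finType) (e : rel T) : Prop :=
  symmetric e /\ irreflexive e.

(* Edges are unordered pairs, so each edge is counted once. *)
Definition edge_set (T : finType) (e : rel T) : {set {set T}} :=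
  [set [set xy.1; xy.2] | xy : T * T & e xy.1 xy.2].

Definition nb_edges (T : finType) (e : rel T) : nat := #|edge_set e|.

Definition hamiltonian_path (T : finType) (e : rel T) (x : T) (p : seq T) :
  Prop := [/\ path e x p, uniq (x :: p) & forall v : T, v \in x :: p].

Definition traceable (T : finType) (e : rel T) : Prop :=
  exists (x : T) (p : seq T), hamiltonian_path e x p.

Definition add_edge (T : finType) (e : rel T) (x y : T) : rel T :=
  fun u v => [|| e u v, (u == x) && (v == y) | (u == y) && (v == x)].

Definition maximal_nontraceable (T : finType) (e : rel T) : Prop :=
  ~ traceable e /\
  (forall x y : T, x != y -> ~~ e x y -> traceable (add_edge e x y)).

(* Main.v *)
(* A graph with a closed set of vertices (no edge leaves it) is maximal
   nontraceable only if the set and its complement are cliques. Call (A, x) a pendant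
   if every edge leaving A ends in x: a hamiltonian path starts or ends in A, so three
   disjoint pendants forbid traceability, and by maximality the sets A + x and
   the rest are cliques. Both cases have enough edges; the second one is extremal for
   orders 8 and 9.
   Otherwise degrees are averaged. In a path whose internal vertices have no
   neighbours outside the path, all vertices are adjacent; hence the neighbours of a
   vertex v of degree two are adjacent, and either both have degree at least four, in
   which case each gives 1/2 to v, or v lies in a pendant triangle. Only vertices of
   degree one and pendant triangles keep a deficit, of total 2 each, and there are at
   most two of these units. For two units, attached at x1 and x2, a hamiltonian path
   crosses the rest H of the graph by a spanning path of H, from a neighbour of x1 to
   one of x2; adding edges between x1 or x2 and H shows that x1 and x2 together
   have a surplus greater than 1, so the sum of (degree - 3) is at least -2. *)
Require Import Defs.
From mathcomp Require Import all_boot all_order all_algebra.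
From mathcomp Require Import zify.
Import Order.TTheory GRing.Theory Num.Theory.

Set Implicit Arguments.
Unset Strict Implicit.
Unset Printing Implicit Defensive.

(** * Hamiltonian paths as sequences, and the effect of adding an edge *)

Section SpanningSequences.

Variable T : finType.
Implicit Types (r e : rel T) (A H S : {set T}) (s p q : seq T).

(** Only steps between members of [s] are constrained, so the lemma applies to a piece of a path
    that avoids a cutvertex attaching [A] to the rest. *)
Lemma sorted_mem_const r A s :
    sorted r s -> {in s &, forall u w, r u w -> (u \in A) = (w \in A)} ->
  {in s &, forall u w, (u \in A) = (w \in A)}.
Proof.
case: s => // x p /=; elim: p x => [|y p IHp] x /=.
  by move=> _ _ u w; rewrite !inE => /eqP-> /eqP->.
case/andP=> rxy pth cst.
have sub : {subset y :: p <= [:: x, y & p]} by move=> z zp; rewrite inE zp orbT.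
have {}IHp := IHp y pth (sub_in2 sub cst).
have xy : (x \in A) = (y \in A) by apply: cst; rewrite // !inE eqxx ?orbT.
have all_y u : u \in [:: x, y & p] -> (u \in A) = (y \in A).
  by rewrite inE => /predU1P[-> //|uyp]; apply: IHp; rewrite // mem_head.
by move=> u w uP wP; rewrite (all_y u) // (all_y w).
Qed.

Lemma sorted_rev_sym r s : symmetric r -> sorted r (rev s) = sorted r s.
Proof. by move=> rsym; rewrite rev_sorted; apply: eq_sorted => x y; rewrite rsym. Qed.

Lemma sorted_rconsW r s x : sorted r (rcons s x) -> sorted r s.
Proof. by rewrite -cats1; case: s => //= y t; rewrite cat_path => /andP[]. Qed.

(** A hamiltonian path as one list instead of a head and a tail, so that it can be cut and reversed
    freely; [traceableP] relates the two forms. *)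
Definition spanning r s := [/\ sorted r s, uniq s & forall v : T, v \in s].

Lemma spanning_rev r s : symmetric r -> spanning r s -> spanning r (rev s).
Proof.
move=> rsym [srt unq full].
by split=> [||v]; rewrite ?sorted_rev_sym // ?rev_uniq ?mem_rev.
Qed.

Lemma traceableP r : 0 < #|T| -> traceable r <-> exists s, spanning r s.
Proof.
move=> /card_gt0P[x0 _]; split; first by move=> [x [p [? ? ?]]]; exists (x :: p).
by move=> [[|x p] [? ? full]]; [have := full x0 | exists x, p].
Qed.

Lemma mem_split s a : a \in s -> exists p1 p2, s = p1 ++ a :: p2.
Proof. by case/splitPr=> p1 p2; exists p1, p2. Qed.

(** Reversing the path if necessary puts [a] before [b]. *)
Lemma spanning_split2 r s a b :
    symmetric r -> spanning r s -> a != b ->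
  exists p1 p2 p3, spanning r (p1 ++ a :: p2 ++ b :: p3).
Proof.
move=> rsym spn aNb.
have [_ _ full] := spn; have [p1 [p3 def_s]] := mem_split (full a).
have := full b; rewrite def_s mem_cat inE eq_sym (negbTE aNb) /= => /orP[].
  case/mem_split=> p4 [p2 def_p1]; exists (rev p3), (rev p2), (rev p4).
  move: (spanning_rev rsym spn); rewrite def_s def_p1.
  by rewrite !(rev_cat, rev_cons) -!cats1 -!catA /=.
by case/mem_split=> p2 [p4 def_p3]; exists p1, p2, p4; rewrite -def_p3 -def_s.
Qed.

Lemma add_edge_sym e u v : symmetric e -> symmetric (add_edge e u v).
Proof.
move=> esym x y; rewrite /add_edge esym.
by case: (x == u); case: (x == v); case: (y == u); case: (y == v).
Qed.

Lemma add_edgeE e u v x y :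
    ~~ ((x == u) && (y == v)) -> ~~ ((x == v) && (y == u)) ->
  add_edge e u v x y = e x y.
Proof. by rewrite /add_edge => /negbTE-> /negbTE->; rewrite !orbF. Qed.

Lemma add_edgeNl e u v x y : x != u -> x != v -> add_edge e u v x y = e x y.
Proof. by move=> xu xv; rewrite add_edgeE // (negbTE xu, negbTE xv). Qed.

Lemma add_edgeNr e u v x y : y != u -> y != v -> add_edge e u v x y = e x y.
Proof. by move=> xu xv; rewrite add_edgeE // ?(negbTE xu) ?(negbTE xv) ?andbF. Qed.

End SpanningSequences.

(** * Paths whose internal vertices have no neighbours outside *)

Section ClosedPaths.

Variables (T : finType) (e : rel T).
Hypotheses (esy : symmetric e) (eirr : irreflexive e).
Implicit Types (a b u v : T) (p q l m : seq T).

Lemma spanning_insert a b q l m :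
    path e a (rcons q b) -> uniq (a :: rcons q b) ->
    sorted e (rcons l a) -> sorted e (b :: m) -> uniq (l ++ m) ->
    (forall x, (x \in l ++ m) = (x \notin a :: rcons q b)) ->
  spanning e (l ++ (a :: rcons q b) ++ m).
Proof.
move=> Qpath Quniq la bm lm_uniq lmE; split.
- rewrite /= sorted_cat_cons la cat_rcons -cat_rcons cat_path Qpath last_rcons.
  exact: bm.
- rewrite uniq_catCA cat_uniq Quniq lm_uniq andbT /=.
  by apply/hasPn=> x; rewrite lmE.
- move=> x; rewrite mem_cat [in X in _ || X]mem_cat orbCA -mem_cat lmE.
  exact: orbN.
Qed.

(* Outside the internal vertices of the path, the spanning sequence has three
   pieces, cut at the ends of the path; each piece lies either entirely inside or
   entirely outside the path. One of them lies inside, so the other two can be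
   reattached to the ends of the path. *)
Lemma closed_path_reroute u v a b q p1 p2 p3 :
    let Q := a :: rcons q b in
    path e a (rcons q b) -> uniq Q -> q != [::] ->
    {in q, forall i w, e i w -> w \in Q} ->
    u \in Q -> v \in Q -> u != v ->
    spanning (add_edge e u v) (p1 ++ a :: p2 ++ b :: p3) ->
  exists s, spanning e s.
Proof.
move=> Q Qpath Quniq q_n0 qcl uQ vQ uNv [srt unq full].
(* [f] deletes the vertices of [Q] from a piece; they come back together when [Q] is inserted as a
   block. *)
set r := add_edge e u v in srt; pose f p := [seq x <- p | x \notin Q].
have rsym : symmetric r by apply: add_edge_sym.
have QE x : (x \in Q) = [|| x == a, x == b | x \in q].
  by rewrite inE mem_rcons inE.
have qclr : {in q, forall i w, r i w -> w \in Q}.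
  move=> i iq w /or3P[eiw|/andP[_ /eqP-> //]|/andP[_ /eqP-> //]].
  exact: qcl eiw.
(* Both ends of the new edge lie in [Q], so a sequence meeting [Q] in at most one vertex cannot use
   it. *)
have real t c : {in t, forall x, x \notin Q \/ x = c} -> sorted r t -> sorted e t.
  move=> tP; have inQ w : w \in Q -> w \in t -> w = c.
    by move=> wQ wt; case: (tP w wt); rewrite ?wQ.
  apply: (@sub_in_sorted _ (mem t)); last by apply/allP.
  move=> x y xt yt /or3P[//||] /andP[/eqP xE /eqP yE]; subst x y; case/eqP: uNv.
    exact: etrans (inQ u uQ xt) (esym (inQ v vQ yt)).
  exact: etrans (inQ u uQ yt) (esym (inQ v vQ xt)).
have dich p : a \notin p -> b \notin p -> sorted r p ->
    (f p = [::] /\ {subset p <= Q}) \/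
    (f p = p /\ {in p, forall x, x \notin Q /\ x \notin q}).
  move=> aNp bNp psrt.
  have pQ x : x \in p -> (x \in Q) = (x \in q).
    move=> xp; rewrite QE.
    by rewrite (negbTE (memPn aNp x xp)) (negbTE (memPn bNp x xp)).
  have cst : {in p &, forall x y, (x \in [set z | z \in q]) = (y \in [set z | z \in q])}.
    apply: sorted_mem_const psrt _ => x y xp yp rxy; rewrite !inE.
    apply/idP/idP=> [xq|yq]; rewrite -pQ //; first exact: qclr rxy.
    by apply: qclr yq _ _; rewrite rsym.
  case: (boolP (has (mem q) p)) => [/hasP[i ip /= iq]|/hasPn pNq].
    have sub : {subset p <= Q}.
      by move=> x xp; rewrite pQ //; move: (cst x i xp ip); rewrite !inE iq.
    left; split=> //; apply/eqP; rewrite -[_ == _]negbK -has_filter.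
    by apply/hasPn=> x /sub; rewrite negbK.
  right; split=> [|x xp]; last by rewrite pQ //; split; apply: pNq.
  by apply/all_filterP/allP=> x xp; rewrite pQ //; apply: pNq.
move: srt; rewrite sorted_cat_cons /= -cat_rcons cat_path last_rcons => /and3P[s1 s2 s3].
move: unq; rewrite cat_uniq /= cat_uniq /= mem_cat inE !negb_or.
case/and5P=> u1; rewrite has_cat /= !negb_or.
case/and4P=> a1 d12 b1 d13 /and3P[a2 aNb a3] u2 /and3P[/andP[b2 d23] b3 u3].
have sp1 : sorted r p1 by exact: sorted_rconsW s1.
have sp2 : sorted r p2 by move: s2; rewrite rcons_path => /andP[/path_sorted].
have sp3 : sorted r p3 by apply: path_sorted s3.
have D1 := dich p1 a1 b1 sp1; have D2 := dich p2 a2 b2 sp2.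
have D3 := dich p3 a3 b3 sp3.
have k1 : sorted e (rcons (f p1) a).
  case: D1 => -[-> // P]; apply: (real (rcons p1 a) a) s1 => x.
  by rewrite mem_rcons inE => /predU1P[->|/P[]]; [right|left].
have k3 : sorted e (b :: f p3).
  case: D3 => -[-> // P]; apply: (real (b :: p3) b) s3 => x.
  by rewrite inE => /predU1P[->|/P[]]; [right|left].
have k2 : sorted e (a :: f p2).
  case: D2 => -[-> // P]; apply: (real (a :: p2) a).
    by move=> x; rewrite inE => /predU1P[->|/P[]]; [right|left].
  by move: s2; rewrite rcons_path => /andP[].
have k2r : sorted e (rcons (f p2) b).
  case: D2 => -[-> // P]; apply: (real (rcons p2 b) b).
    by move=> x; rewrite mem_rcons inE => /predU1P[->|/P[]]; [right|left].
  exact: path_sorted s2.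
have fu : uniq (f p1 ++ f p2 ++ f p3).
  rewrite -!filter_cat filter_uniq // !cat_uniq u1 u2 u3 has_cat !negb_or.
  by rewrite d12 d13 d23.
have fE x : (x \in f p1 ++ f p2 ++ f p3) = (x \notin Q).
  rewrite -!filter_cat mem_filter; case: (boolP (x \notin Q)) => //= xQ.
  move: (full x) xQ; rewrite QE !(mem_cat, inE) !negb_or => F /and3P[xa xb _].
  by move: F; rewrite (negbTE xa) (negbTE xb).
have [i iq] : exists i, i \in q.
  by case: (q) q_n0 => // i t _; exists i; apply: mem_head.
have [ia ib] : i != a /\ i != b.
  move: Quniq; rewrite /Q /= mem_rcons rcons_uniq inE negb_or => /and3P[/andP[_ aq] bq _].
  by split; [apply: (memPn aq) | apply: (memPn bq)].
have fi p : f p = p /\ {in p, forall x, x \notin Q /\ x \notin q} -> i \notin p.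
  by case=> _ P; apply/negP=> /P[_]; rewrite iq.
(* The piece containing the internal vertex [i] lies inside [Q], hence is emptied by [f]. *)
have : [|| f p1 == [::], f p2 == [::] | f p3 == [::]].
  case: D1 => [[-> //]|/fi i1]; case: D2 => [[-> _]|/fi i2]; first by rewrite eqxx orbT.
  case: D3 => [[-> _]|/fi i3]; first by rewrite eqxx !orbT.
  move: (full i); rewrite !(mem_cat, inE).
  by rewrite (negbTE i1) (negbTE i2) (negbTE i3) (negbTE ia) (negbTE ib).
(* If an outer piece is the empty one, the middle piece is reversed and attached in its place: it
   can follow [a] by [k2] and precede [b] by [k2r]. *)
case/or3P=> /eqP fp; rewrite fp /= ?cats0 in fu fE.
- exists (rev (f p2) ++ Q ++ f p3); apply: spanning_insert => //.
  + by rewrite -rev_cons sorted_rev_sym.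
  + by rewrite (perm_uniq (_ : perm_eq _ (f p2 ++ f p3))) // perm_cat2r perm_rev.
  + by move=> x; rewrite mem_cat mem_rev -mem_cat.
- by exists (f p1 ++ Q ++ f p3); apply: spanning_insert.
- exists (f p1 ++ Q ++ rev (f p2)); apply: spanning_insert => //.
  + by rewrite -[b :: _]revK rev_cons revK sorted_rev_sym.
  + by rewrite (perm_uniq (_ : perm_eq _ (f p1 ++ f p2))) // perm_cat2l perm_rev.
  + by move=> x; rewrite mem_cat mem_rev -mem_cat.
Qed.

(** If two vertices [u], [v] of the path were nonadjacent, a hamiltonian path of the graph with [uv]
    added could be rerouted along the given path, which avoids [uv]. *)
Lemma closed_path_clique a b q :
    maximal_nontraceable e ->
    path e a (rcons q b) -> uniq (a :: rcons q b) -> q != [::] ->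
    {in q, forall i w, e i w -> w \in a :: rcons q b} ->
  {in a :: rcons q b &, forall u v, u != v -> e u v}.
Proof.
move=> [nontr mx] Qpath Quniq q_n0 qcl u v uQ vQ uNv; apply/negPn/negP=> nuv.
have T_gt0 : 0 < #|T| by apply/card_gt0P; exists a.
have /(traceableP _ T_gt0)[s spn] := mx u v uNv nuv.
have aNb : a != b by move: Quniq; rewrite /= mem_rcons inE negb_or => /andP[/andP[]].
have [p1 [p2 [p3 spn2]]] := spanning_split2 (add_edge_sym u v esy) spn aNb.
apply/nontr/traceableP => //.
exact: (closed_path_reroute Qpath Quniq q_n0 qcl uQ vQ uNv spn2).
Qed.

End ClosedPaths.

(** * Pendants and their effect on hamiltonian paths *)

Section Pendants.

Variable T : finType.
Implicit Types (r e : rel T) (A H : {set T}) (x y u v : T) (s p : seq T).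

Definition pendant r A x :=
  [/\ A != set0, x \notin A & {in A, forall a b, r a b -> b \in x |: A}].

Lemma pendant_mem_const r A x p :
    symmetric r -> pendant r A x -> sorted r p -> x \notin p ->
  {in p &, forall u w, (u \in A) = (w \in A)}.
Proof.
move=> rsym [_ _ Acl] psrt xp; apply: (sorted_mem_const psrt) => u w up wp ruw.
have [ux wx] := (memPn xp u up, memPn xp w wp).
apply/idP/idP=> [uA|wA]; first by have := Acl u uA w ruw; rewrite !inE (negbTE wx).
by have := Acl w wA u; rewrite rsym !inE (negbTE ux); apply.
Qed.

(** Removing [x] cuts the path into two pieces, each wholly inside or wholly outside [A]. A piece
    inside [A] contains an end of the path. *)
Lemma pendant_end r A x y p :
    symmetric r -> pendant r A x -> spanning r (y :: p) ->
  (y \in A) || (last y p \in A).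
Proof.
move=> rsym pA [srt unq full]; have [A0 xA _] := pA.
have [p1 [p2 def_p]] := mem_split (full x).
move: srt unq; rewrite def_p sorted_cat_cons => /andP[s1 s2].
rewrite cat_uniq /= negb_or => /and4P[_ /andP[xp1 _] xp2 _].
have {}s1 : sorted r p1.
  exact: sorted_rconsW s1.
have [a aA] := set0Pn _ A0; have := full a.
have -> : last y p = last x p2 by rewrite -[last y p]/(last y (y :: p)) def_p last_cat.
rewrite def_p mem_cat inE => /or3P[ap1|/eqP ax|ap2].
- have yp1 : y \in p1.
    by case: (p1) ap1 def_p => // z t _ [-> _]; apply: mem_head.
  by rewrite (pendant_mem_const rsym pA s1 xp1 yp1 ap1) aA.
- by rewrite -ax aA in xA.
- have lp2 : last x p2 \in p2 by case: (p2) ap2 => //= z t _; apply: mem_last.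
  by rewrite (pendant_mem_const rsym pA (path_sorted s2) xp2 lp2 ap2) aA orbT.
Qed.

Lemma pendant_add_edge e A x u v :
    pendant e A x -> (u \notin A) && (v \notin A) || (u \in x |: A) && (v \in x |: A) ->
  pendant (add_edge e u v) A x.
Proof.
move=> [A0 xA Acl] uvA; split=> // a aA b.
case/or3P=> [|/andP[/eqP au /eqP bv]|/andP[/eqP av /eqP bu]].
- exact: Acl.
- by case/orP: uvA => /andP[]; rewrite -bv // -au aA.
- by case/orP: uvA => /andP[]; rewrite -bu // -av aA.
Qed.

(** The attachment vertices [x i] may coincide, which covers several pendants at one cutvertex. *)
Definition three_pendants e (A : 'I_3 -> {set T}) (x : 'I_3 -> T) :=
  [/\ forall i, pendant e (A i) (x i),
      forall i j, i != j -> [disjoint A i & A j]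
    & forall i j, x i \notin A j].

Lemma three_pendants_nontraceable e (A : 'I_3 -> {set T}) (x : 'I_3 -> T) :
  symmetric e -> three_pendants e A x -> ~ traceable e.
Proof.
move=> es [pA dA _] [y [p [srt unq full]]].
(* Pigeonhole: [b] records which end of the path is charged to [A i], and three disjoint sets cannot
   share two ends. *)
pose b i := y \in A i.
suff /leq_card : injective b by rewrite card_ord card_bool.
have b_end i : if b i then y \in A i else last y p \in A i.
  by have := pendant_end es (pA i) (And3 srt unq full); rewrite /b; case: ifP.
move=> i j bij; apply/eqP/negPn/negP=> /dA dij.
have := b_end i; have := b_end j; rewrite -bij.
by case: (b i) => yj yi; have := disjointFr dij yi; rewrite yj.
Qed.

Definition spans r H y1 y2 :=
  exists p, [/\ path r y1 p, last y1 p = y2, uniq (y1 :: p) &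
               forall w, (w \in y1 :: p) = (w \in H)].

(** Write the path as [p1], [x1], [p2], [x2], [p3]. The part after [x1] contains [x2], so it misses
    [A1]; hence [A1] meets [p1], which then lies in [A1]. Symmetrically [p3] lies in [A2], and [p2]
    is left to cover exactly [H]. *)
Lemma two_pendants_spans r A1 A2 x1 x2 :
    symmetric r -> pendant r A1 x1 -> pendant r A2 x2 ->
    x1 != x2 -> x1 \notin A2 -> x2 \notin A1 -> [disjoint A1 & A2] ->
    let H := ~: (x1 |: (x2 |: A1 :|: A2)) in H != set0 -> traceable r ->
  exists y1 y2, [/\ r x1 y1, r x2 y2 & spans r H y1 y2].
Proof.
move=> rsym pA1 pA2 x1x2 x1A2 x2A1 dA H H0 tr.
have T_gt0 : 0 < #|T| by apply/card_gt0P; exists x1.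
have /(traceableP _ T_gt0)[s spn] := tr.
have [p1 [p2 [p3 [srt unq full]]]] := spanning_split2 rsym spn x1x2.
move: unq; rewrite cat_uniq /= cat_uniq /= mem_cat inE !negb_or.
case/and5P=> _; rewrite has_cat /= !negb_or.
case/and4P=> a1 _ b1 _ /and3P[a2 _ a3] u2 /and3P[/andP[b2 _] b3 _].
have := srt; rewrite sorted_cat_cons => /andP[s1 s23].
have [s12 s2 s3] : [/\ sorted r (p1 ++ x1 :: p2), sorted r (rcons p2 x2) & path r x2 p3].
  have: sorted r ((p1 ++ x1 :: p2) ++ x2 :: p3) by rewrite -catA.
  rewrite sorted_cat_cons rcons_cat /= sorted_cat_cons.
  rewrite sorted_cat_cons rcons_path => /andP[/and3P[-> -> lx2] ->]; split=> //.
  apply: (@path_sorted _ r x1); rewrite rcons_path lx2 andbT.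
  by move: s23; rewrite cat_path => /andP[].
have x2p12 : x2 \notin p1 ++ x1 :: p2.
  by rewrite mem_cat inE !negb_or b1 b2 eq_sym x1x2.
have x1p23 : x1 \notin p2 ++ x2 :: p3.
  by rewrite mem_cat inE !negb_or a2 a3 x1x2.
have no1 w : w \in p2 ++ x2 :: p3 -> w \notin A1.
  move=> wp; rewrite (pendant_mem_const rsym pA1 (path_sorted s23) x1p23 wp (_ : x2 \in _)) //.
  by rewrite mem_cat mem_head orbT.
have no2 w : w \in p1 ++ x1 :: p2 -> w \notin A2.
  move=> wp; rewrite (pendant_mem_const rsym pA2 s12 x2p12 wp (_ : x1 \in _)) //.
  by rewrite mem_cat mem_head orbT.
have [/set0Pn[a aA1] x1A1 _] := pA1; have [/set0Pn[c cA2] x2A2 _] := pA2.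
have in1 w : w \in p1 -> w \in A1.
  have ap : a \in p1.
    have := full a; rewrite mem_cat inE => /or3P[//|/eqP ax|/no1]; last by rewrite aA1.
    by rewrite -ax aA1 in x1A1.
  move=> wp; rewrite (pendant_mem_const rsym pA1 _ a1 wp ap) //.
  exact: sorted_rconsW s1.
have in3 w : w \in p3 -> w \in A2.
  have cp : c \in p3.
    have := full c; rewrite -cat_cons catA mem_cat inE => /or3P[/no2|/eqP cx|//].
      by rewrite cA2.
    by rewrite -cx cA2 in x2A2.
  by move=> wp; rewrite (pendant_mem_const rsym pA2 (path_sorted s3) b3 wp cp).
have p2H w : (w \in p2) = (w \in H).
  apply/idP/idP=> [wp|].
    rewrite !inE !negb_or (memPn a2) // (memPn b2) //.
    by rewrite no1 ?no2 // mem_cat ?inE wp ?orbT.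
  rewrite !inE !negb_or => /and3P[wx1 /andP[wx2 wA1] wA2].
  have := full w; rewrite !(mem_cat, inE) (negbTE wx1) (negbTE wx2) /=.
  case/or3P=> // [/in1|/in3]; first by rewrite (negbTE wA1).
  by rewrite (negbTE wA2).
case: p2 => [|y1 p] in a2 u2 b2 s2 srt s12 s23 full x2p12 x1p23 no1 no2 p2H *.
  by have [w wH] := set0Pn _ H0; have := p2H w; rewrite wH.
exists y1, (last y1 p); split.
- by move: s23 => /= /andP[].
- by move: s2; rewrite /= rcons_path rsym => /andP[].
- by exists p; split=> //; move: s2; rewrite /= rcons_path => /andP[].
Qed.

End Pendants.

(** * Degree sums for disconnected graphs and for graphs with three pendants *)

Section Degrees.

Variables (T : finType) (e : rel T).
Hypotheses (esy : symmetric e) (eirr : irreflexive e).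
Implicit Types (A B : {set T}) (u v w : T).

Definition nbh v := [set w | e v w].
Definition deg v := #|nbh v|.

Lemma edge_neq v w : e v w -> v != w.
Proof. by apply: contraTneq => ->; rewrite eirr. Qed.

Lemma degE v : deg v = \sum_w e v w.
Proof. by rewrite /deg -sum1dep_card big_mkcond; apply: eq_bigr => w _; case: (e v w). Qed.

Lemma handshake : \sum_v deg v = 2 * nb_edges e.
Proof.
pose P := [set vw : T * T | e vw.1 vw.2].
pose f (vw : T * T) := [set vw.1; vw.2].
have -> : \sum_v deg v = #|P|.
  transitivity (\sum_v \sum_(w | e v w) 1).
    by apply: eq_bigr => v _; rewrite sum1dep_card.
  by rewrite pair_big_dep sum1dep_card.
(* Ordered adjacent pairs are grouped by their underlying edge; each group consists of the two
   orientations. *)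
rewrite -sum1_card (partition_big f (mem (f @: P))) => [|p pP]; last exact: imset_f.
have -> : nb_edges e = #|f @: P|.
  by apply: eq_card => E; apply/imsetP/imsetP=> -[p pP ->]; exists p.
rewrite -sum1_card big_distrr /=; apply: eq_bigr => E /imsetP[[v w]].
rewrite inE /= => evw ->.
rewrite (eq_bigl (mem [set (v, w); (w, v)])) => [|[a b]]; last first.
  rewrite !inE /= !xpair_eqE; apply/andP/orP; last first.
    case=> /andP[/eqP-> /eqP->]; first by rewrite evw.
    by rewrite esy evw /f /= setUC.
  case=> eab /eqP fE; have aNb := edge_neq eab.
  have := set21 a b; have := set22 a b.
  rewrite -[[set a; b]]/(f (a, b)) fE !inE.
  move=> /pred2P[]/= bE /pred2P[]/= aE; rewrite aE bE !eqxx; [|by right|by left|];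
    by rewrite aE bE eqxx in aNb.
by rewrite sum1_card cards2 xpair_eqE negb_and (edge_neq evw).
Qed.

Lemma clique_sum B v :
    {in B &, forall u w, u != w -> e u w} -> v \in B ->
  #|B| <= (\sum_(w in B) e v w).+1.
Proof.
move=> Bcl vB; rewrite (cardsD1 v) vB add1n ltnS -sum1_card.
rewrite [leqRHS](bigD1 v) //= eirr add0n.
rewrite (eq_bigl (fun w => (w \in B) && (w != v))) => [|w]; last by rewrite !inE andbC.
apply: leq_sum => w /andP[wB wv]; by rewrite Bcl // eq_sym.
Qed.

Lemma clique_deg B v :
    {in B &, forall u w, u != w -> e u w} -> v \in B -> #|B| <= (deg v).+1.
Proof.
move=> Bcl vB; apply: leq_trans (clique_sum Bcl vB) _.
by rewrite ltnS degE [leqRHS](bigID (mem B)) /= leq_addr.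
Qed.

Definition closed_set A := {in A, forall a b, e a b -> b \in A}.

Lemma closed_setC A : closed_set A -> closed_set (~: A).
Proof.
move=> Acl a; rewrite !inE => aA b eab; rewrite inE; apply: contra aA => bA.
by apply: Acl bA _ _; rewrite esy.
Qed.

(** An edge added inside [A] leaves [A] closed, so a hamiltonian path of the new graph would have to
    stay in [A]. *)
Lemma closed_set_clique A :
    maximal_nontraceable e -> closed_set A -> A != setT ->
  {in A &, forall u w, u != w -> e u w}.
Proof.
move=> [nontr mx] Acl AT u v uA vA uv; apply/negPn/negP=> nuv.
have [x [p [pth unq full]]] := mx u v uv nuv.
case/eqP: AT; apply/setP=> w; rewrite inE -uA.
have := @sorted_mem_const T (add_edge e u v) A (x :: p) pth _ w u (full w) (full u).
apply=> a b _ _ /or3P[eab|/andP[/eqP-> /eqP->]|/andP[/eqP-> /eqP->]]; last 2 first.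
- by rewrite uA vA.
- by rewrite uA vA.
by apply/idP/idP=> [aA|bA]; [apply: Acl eab | apply: Acl bA _ _; rewrite esy].
Qed.

Lemma closed_set_degree A :
    maximal_nontraceable e -> closed_set A -> A != set0 -> A != setT ->
  7 * #|T| <= \sum_v deg v + 32.
Proof.
move=> mnt Acl A0 AT.
have ACT : ~: A != setT by apply: contraNneq A0 => CT; rewrite -[A]setCK CT setCT.
have cA := closed_set_clique mnt Acl AT.
have cC := closed_set_clique mnt (closed_setC Acl) ACT.
rewrite (bigID (mem A)) /=.
have sA : #|A| * #|A|.-1 <= \sum_(v in A) deg v.
  rewrite -sum_nat_const; apply: leq_sum => v vA.
  by have := clique_deg cA vA; lia.
have sC : #|~: A| * #|~: A|.-1 <= \sum_(v | v \notin A) deg v.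
  rewrite -sum_nat_const (eq_bigl (fun v => v \notin A)) => [|v]; last by rewrite inE.
  apply: leq_sum => v vA; have := clique_deg cC (_ : v \in ~: A).
  by rewrite inE vA => /(_ isT); lia.
(* This is (a - 4)^2 >= 0, a linear lower bound for the degree sum of a clique of order a; two such
   bounds give the 32. *)
have h a : 7 * a <= a * a.-1 + 16 by case: a => [|a] //=; case: (leqP a 3) => ?; nia.
rewrite -(cardsC A) mulnDr.
have hA := leq_trans (h #|A|) (leq_add sA (leqnn 16)).
have hC := leq_trans (h #|~: A|) (leq_add sC (leqnn 16)).
by apply: leq_trans (leq_add hA hC) _; rewrite addnACA.
Qed.

(** Adding such an edge [uv] keeps all three pendants, so the graph would stay nontraceable. *)
Lemma three_pendants_clique (A : 'I_3 -> {set T}) (x : 'I_3 -> T) u v :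
    maximal_nontraceable e -> three_pendants e A x ->
    (forall i, (u \notin A i) && (v \notin A i)) \/
      (exists i, (u \in x i |: A i) && (v \in x i |: A i)) ->
  u != v -> e u v.
Proof.
move=> [_ mx] [pA dA xA] uvP uv; apply/negPn/negP=> nuv.
apply: (@three_pendants_nontraceable _ (add_edge e u v) A x _ _ (mx u v uv nuv)).
  exact: add_edge_sym.
split=> // i; apply: pendant_add_edge (pA i) _; case: uvP => [-> //|[j uvj]].
case: (eqVneq i j) => [->|ij]; first by rewrite uvj orbT.
apply/orP; left; have {uvj} [uj vj] := andP uvj.
have out w : w \in x j |: A j -> w \notin A i.
  rewrite in_setU1 => /predU1P[->|wj]; first exact: xA.
  by rewrite (disjointFl (dA _ _ ij)).
by rewrite !out.
Qed.

(** The graph consists of a clique [C] and three cliques [x i |: A i] attached to it. Each [A i]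
    contributes at least |A i|^2 through its own vertices and |A i| more through the degree of
    [x i]. *)
Lemma three_pendants_degree (A : 'I_3 -> {set T}) (x : 'I_3 -> T) :
    maximal_nontraceable e -> three_pendants e A x ->
  4 * #|T| <= \sum_v deg v + 12.
Proof.
move=> mnt tp; have [pA dA xA] := tp; pose C := ~: \bigcup_i A i.
have inC v : (v \in C) = [forall i, v \notin A i].
  rewrite inE; apply/idP/forallP => [|vA].
    by move=> vA i; apply: contra vA => vi; apply/bigcupP; exists i.
  by apply/bigcupP=> -[i _]; rewrite (negbTE (vA i)).
have part (F : T -> nat) :
    \sum_w F w = \sum_(w in C) F w + \sum_i \sum_(w in A i) F w.
  rewrite (bigID (mem C)) /=; congr addn.
  under [RHS]eq_bigr => i _ do rewrite big_mkcond.
  rewrite exchange_big /= [RHS](bigID (mem C)) /= [X in _ = X + _]big1 ?add0n; last first.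
    move=> w; rewrite inC => /forallP wA; apply: big1 => i _.
    by rewrite (negbTE (wA i)).
  apply: eq_bigr => w; rewrite inC negb_forall => /existsP[i]; rewrite negbK => wi.
  rewrite (bigD1 i) //= wi big1 ?addn0 // => j ji.
  by rewrite (disjointFr (dA i j _)) // eq_sym.
have cC : {in C &, forall u w, u != w -> e u w}.
  move=> u w; rewrite !inC => /forallP uC /forallP wC.
  by apply: three_pendants_clique mnt tp _; left=> i; rewrite uC wC.
have cA i : {in x i |: A i &, forall u w, u != w -> e u w}.
  by move=> u w ui wi; apply: three_pendants_clique mnt tp _; right; exists i; rewrite ui.
have xC i : x i \in C by rewrite inC; apply/forallP=> j; apply: xA.
have cardA i : #|x i |: A i| = #|A i|.+1 by rewrite cardsU1 xA.
have degA i : #|A i| * #|A i| <= \sum_(v in A i) deg v.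
  rewrite -sum_nat_const; apply: leq_sum => v vi.
  by rewrite -ltnS -cardA; apply: clique_deg (cA i) _; rewrite in_setU1 vi orbT.
have xAsum i : #|A i| <= \sum_(v in C) \sum_(w in A i) e v w.
  rewrite (bigD1 (x i)) //= -sum1_card; apply: leq_trans (leq_addr _ _).
  apply: leq_sum => w wi; rewrite (cA i) ?setU11 // ?in_setU1 ?wi ?orbT //.
  by apply: contraNneq (xA i i) => ->.
have sC : #|C| * #|C|.-1 <= \sum_(v in C) \sum_(w in C) e v w.
  rewrite -sum_nat_const; apply: leq_sum => v vC.
  by have := clique_sum cC vC; lia.
have degC : \sum_(v in C) deg v =
    \sum_(v in C) \sum_(w in C) e v w + \sum_i \sum_(v in C) \sum_(w in A i) e v w.
  rewrite [X in _ = _ + X]exchange_big -big_split; apply: eq_bigr => v _.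
  by rewrite degE part.
have -> : #|T| = #|C| + \sum_i #|A i|.
  transitivity (\sum_(w : T) 1); first by rewrite -sum1_card; apply: eq_bigl.
  by rewrite part sum1_card; congr addn; apply: eq_bigr => i _; rewrite sum1_card.
have C_gt0 : 0 < #|C| by apply/card_gt0P; exists (x ord0).
rewrite part degC !big_ord_recl !big_ord0.
set i0 := ord0; set i1 := lift _ _; set i2 := lift _ _.
have [x0 x1 x2] : [/\ _, _ & _] := And3 (xAsum i0) (xAsum i1) (xAsum i2).
have [d0 d1 d2] : [/\ _, _ & _] := And3 (degA i0) (degA i1) (degA i2).
(* These are (a - 1)(a - 2) >= 0 and (m - 2)(m - 3) >= 0 on integers; the constants add up to 3 * 2
   + 6 = 12. *)
have h a : 3 * a <= a * a + 2 by case: (leqP a 1) => ?; nia.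
have hm m : 0 < m -> 4 * m <= m * m.-1 + 6.
  by case: m => [|k] //= _; case: (leqP k 2) => ?; nia.
have hC := leq_trans (hm _ C_gt0) (leq_add sC (leqnn 6)).
have h0 := leq_trans (h _) (leq_add d0 (leqnn 2)).
have h1 := leq_trans (h _) (leq_add d1 (leqnn 2)).
have h2 := leq_trans (h _) (leq_add d2 (leqnn 2)).
move: hC h0 h1 h2 x0 x1 x2; clear; lia.
Qed.

End Degrees.

(** * Vertices of degree at most two in a connected graph *)

Section LocalStructure.

Variables (T : finType) (e : rel T).
Hypotheses (esy : symmetric e) (eirr : irreflexive e).
Hypotheses (mnt : maximal_nontraceable e) (T_gt7 : 7 < #|T|).
Hypothesis conn : forall A, closed_set e A -> A != set0 -> A = setT.
Implicit Types (A B H : {set T}) (u v w x y z : T) (t p : seq T).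

Notation nbh := (nbh e).
Notation deg := (deg e).

Lemma in_nbh v w : (w \in nbh v) = e v w. Proof. by rewrite inE. Qed.

(** Rules out configurations that would form a whole component on few vertices. *)
Lemma small_not_closed t : size t < 8 -> t != [::] -> ~ closed_set e [set z in t].
Proof.
move=> t_lt; case: t t_lt => // a t t_lt _ tcl.
have tT : [set z in a :: t] = setT.
  by apply: conn tcl _; apply/set0Pn; exists a; rewrite !inE eqxx.
have := card_size (a :: t); rewrite -cardsE tT cardsT; lia.
Qed.

Lemma deg_gt0 v : 0 < deg v.
Proof.
rewrite card_gt0; apply/negP=> /eqP v0.
apply: (@small_not_closed [:: v]) => // a; rewrite !inE => /eqP-> b evb.
by have := in_nbh v b; rewrite v0 evb in_set0.
Qed.

Lemma nbh_other v x : deg v = 2 -> e v x ->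
  exists y, [/\ nbh v = [set x; y], x != y & y != v].
Proof.
move=> dv evx; have : #|nbh v :\ x| == 1.
  by move: dv; rewrite /deg (cardsD1 x) in_nbh evx add1n => -[->].
case/cards1P=> y vy; have : y \in nbh v :\ x by rewrite vy set11.
rewrite in_setD1 in_nbh => /andP[yx evy]; exists y.
rewrite eq_sym yx -vy setD1K ?in_nbh //; split=> //.
by rewrite eq_sym (edge_neq eirr evy).
Qed.

(** The path [x], [v], [y] has the single internal vertex [v], so its vertices form a clique. *)
Lemma deg2_triangle v x y : nbh v = [set x; y] -> x != y -> e x y.
Proof.
move=> vE xy; have [evx evy] : e v x /\ e v y by rewrite -!in_nbh vE set21 set22.
have pth : path e x (rcons [:: v] y) by rewrite /= esy evx evy.
have unq : uniq (x :: rcons [:: v] y).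
  by rewrite /= !inE negb_or xy (edge_neq eirr evy) (edge_neq eirr) // esy.
apply: (closed_path_clique esy mnt pth unq) => //; rewrite ?mem_head ?inE ?eqxx ?orbT //.
move=> i; rewrite inE => /eqP-> w; rewrite -in_nbh vE !inE.
by case/orP=> ->; rewrite ?orbT.
Qed.

(** If [x] had degree three with third neighbour [z], the path [z], [x], [v], [y] would be closed at
    [x] and [v], making [z] a neighbour of [v]. *)
Lemma deg2_nbh_gt3 v x y : nbh v = [set x; y] -> x != y -> 2 < deg x -> 3 < deg x.
Proof.
move=> vE xy dx; have [evx evy] : e v x /\ e v y by rewrite -!in_nbh vE set21 set22.
have exy := deg2_triangle vE xy.
rewrite ltnNge; apply/negP=> dx3.
have /subsetPn[z] : ~~ (nbh x \subset [set v; y]).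
  by apply: contraL dx => /subset_leq_card; rewrite cards2 -leqNgt; case: (v != y) => [//|/leqW].
rewrite in_nbh !inE negb_or => exz /andP[zv zy].
have xE : nbh x = [set v; y; z].
  apply/esym/eqP; rewrite eqEcard -/(deg x); apply/andP; split.
    apply/subsetP=> w; rewrite !inE => /orP[/orP[]|] /eqP-> //; by rewrite esy.
  rewrite setUC cardsU1 cards2 !inE negb_or zv zy (edge_neq eirr evy).
  exact: dx3.
have pth : path e z (rcons [:: x; v] y) by rewrite /= esy exz esy evx evy.
have unq : uniq (z :: rcons [:: x; v] y).
  rewrite /= !inE !negb_or zy zv xy (edge_neq eirr evy) eq_sym (edge_neq eirr exz).
  by rewrite (edge_neq eirr) // esy.
have : e z v.
  apply: (closed_path_clique esy mnt pth unq) => //; rewrite ?inE ?eqxx ?orbT //.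
  move=> i; rewrite !inE => /orP[]/eqP-> w;
    rewrite -in_nbh ?xE ?vE !inE; do ?[case/orP]; by move=> ->; rewrite ?orbT.
rewrite esy -in_nbh vE !inE (negbTE zy) orbF => /eqP zx.
by rewrite zx eirr in exz.
Qed.

(** If [x] had one more neighbour [y] only, the closed path [v], [x], [y] would make [v] adjacent to
    [y]; with no other neighbour, [v] and [x] would form a component. *)
Lemma leaf_nbh_gt2 v x : nbh v = [set x] -> 2 < deg x.
Proof.
move=> vE; have evx : e v x by rewrite -in_nbh vE set11.
rewrite ltnNge leq_eqVlt; apply/negP=> /orP[/eqP d2|].
  have [|y [xE vy yx]] := @nbh_other x v d2; first by rewrite esy.
  have exy : e x y by rewrite -in_nbh xE set22.
  have pth : path e v (rcons [:: x] y) by rewrite /= evx exy.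
  have unq : uniq (v :: rcons [:: x] y).
    by rewrite /= !inE negb_or vy (edge_neq eirr evx) (edge_neq eirr exy).
  have : e v y.
    apply: (closed_path_clique esy mnt pth unq) => //; rewrite ?inE ?eqxx ?orbT //.
    move=> i; rewrite !inE => /eqP-> w.
    by rewrite -in_nbh xE !inE => /orP[] ->; rewrite ?orbT.
  by rewrite -in_nbh vE inE (negbTE yx).
rewrite ltnS => d1; have {d1} : #|nbh x| == 1 by rewrite eqn_leq d1 deg_gt0.
case/cards1P=> y xE; have := in_nbh x v; rewrite esy evx xE inE => /eqP vy.
apply: (@small_not_closed [:: v; x]) => // a; rewrite !inE => /orP[]/eqP-> b;
  by rewrite -in_nbh ?vE ?xE ?vy !inE => ->; rewrite ?orbT.
Qed.

(** * Degree transfers and the vertices left with a deficit *)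

(* A degree-two vertex is shared between its two neighbours when both have degree
   at least four; otherwise it is one of two such vertices forming a triangle with
   a cutvertex. *)
Definition split2 v := (deg v == 2) && [forall w, e v w ==> (3 < deg w)].
Definition poor v := (deg v < 3) && ~~ split2 v.
(* gain v - load v is twice the degree of v minus 3, after the transfers. *)
Definition load v := 6 + #|[set w in nbh v | split2 w]|.
Definition gain v := 2 * deg v + 2 * split2 v.

(** Either a leaf, or the two vertices of degree two of a pendant triangle; [x] is the attachment
    vertex. [t] is a list because it serves as the end segment of a hamiltonian path. *)
Definition unit t x :=
  (exists2 v, t = [:: v] & nbh v = [set x]) \/
  (exists v w, [/\ t = [:: v; w], nbh v = [set w; x], nbh w = [set v; x]
                 & [&& v != w, v != x & w != x]]).

Lemma split2_other v x : split2 v -> e x v ->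
  exists y, [/\ nbh v = [set x; y], x != y, e x y, 3 < deg x & 3 < deg y].
Proof.
case/andP=> /eqP dv /forallP dw; rewrite esy => evx.
have [y [vE xy _]] := nbh_other dv evx; exists y.
have evy : e v y by rewrite -in_nbh vE set22.
by split; rewrite ?(deg2_triangle vE xy) //; [have := dw x | have := dw y]; rewrite ?evx ?evy.
Qed.

(** A poor [v] of degree two has a neighbour [w] of degree at most three, hence at most two by
    [deg2_nbh_gt3]. The other neighbour [x] of [v] is adjacent to [w], so [v], [w], [x] is a pendant
    triangle. *)
Lemma poor_unit v : poor v -> exists t x, unit t x /\ v \in t.
Proof.
case/andP=> dv nsp; have := deg_gt0 v; rewrite leq_eqVlt => /orP[/eqP d1|d2].
  have /cards1P[x vE] : #|nbh v| == 1 by apply/eqP.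
  by exists [:: v], x; rewrite mem_head; split=> //; left; exists v.
have {}dv : deg v = 2 by lia.
move: nsp; rewrite /split2 dv eqxx negb_forall => /existsP[w].
rewrite negb_imply -leqNgt => /andP[evw dw].
have [x [vE wx xv]] := nbh_other dv evw.
have dw2 : deg w = 2.
  have := contraNN (deg2_nbh_gt3 vE wx); rewrite -!leqNgt => /(_ dw) dw2.
  apply/eqP; rewrite eqn_leq dw2 /deg.
  have <- : #|[set v; x]| = 2 by rewrite cards2 eq_sym xv.
  apply: subset_leq_card; apply/subsetP=> z; rewrite !inE => /orP[]/eqP->.
    by rewrite esy.
  exact: deg2_triangle vE wx.
have [|y [wE vy yw]] := @nbh_other w v dw2; first by rewrite esy.
have : x \in nbh w by rewrite in_nbh (deg2_triangle vE wx).
rewrite wE !inE (negbTE xv) /= => /eqP xy; rewrite -{}xy in wE vy yw.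
exists [:: v; w], x; rewrite mem_head; split=> //; right; exists v, w; split=> //.
by rewrite vy wx (edge_neq eirr evw).
Qed.

Lemma unit_size t x : unit t x -> 0 < size t <= 2.
Proof. by case=> [[v ->]|[v [w [->]]]]. Qed.

Lemma unit_deg t x : unit t x -> size t + 2 <= deg x.
Proof.
case=> [[v -> vE]|[v [w [-> vE wE /and3P[vw vx wx]]]]]; first exact: leaf_nbh_gt2 vE.
apply: (@deg2_nbh_gt3 v x w); rewrite 1?eq_sym // ?vE 1?setUC //.
rewrite ltn_neqAle; apply/andP; split; last first.
  have <- : #|[set v; w]| = 2 by rewrite cards2 vw.
  apply: subset_leq_card; apply/subsetP=> z.
  rewrite in_nbh esy -in_nbh !inE.
  by case/orP=> /eqP->; rewrite -in_nbh ?vE ?wE !inE eqxx orbT.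
apply/eqP=> /esym dx.
have exv : e x v by rewrite esy -in_nbh vE set22.
have exw : e x w by rewrite esy -in_nbh wE set22.
have [y [xE vy yx]] := nbh_other dx exv.
have : w \in nbh x by rewrite in_nbh.
rewrite xE !inE eq_sym (negbTE vw) /= => /eqP wy; subst y.
apply: (@small_not_closed [:: v; w; x]) => // a; rewrite !inE => /or3P[]/eqP-> b;
  by rewrite -in_nbh ?vE ?xE ?wE !inE => /orP[]->; rewrite ?orbT.
Qed.

Lemma unit_pendant t x : unit t x -> pendant e [set z in t] x.
Proof.
case=> [[v -> vE]|[v [w [-> vE wE /and3P[vw vx wx]]]]]; split.
- by apply/set0Pn; exists v; rewrite !inE eqxx.
- rewrite !inE; apply/eqP=> xv; have := in_nbh v x; rewrite vE set11 xv.
  by rewrite eirr.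
- by move=> a; rewrite !inE => /eqP-> b; rewrite -in_nbh vE !inE => ->.
- by apply/set0Pn; exists v; rewrite !inE eqxx.
- by rewrite !inE negb_or eq_sym vx eq_sym wx.
- move=> a; rewrite !inE => /orP[]/eqP-> b; rewrite -in_nbh ?vE ?wE !inE;
    by case/orP=> ->; rewrite ?orbT.
Qed.

Lemma unit_mem_out t x z w : unit t x -> z \in t -> e z w -> w \notin t -> w = x.
Proof.
move=> /unit_pendant[_ _ tcl] zt ezw wt; have := tcl z; rewrite inE zt => /(_ isT w ezw).
by rewrite !inE (negbTE wt) orbF => /eqP.
Qed.

Lemma unit_adj t x z : unit t x -> z \in t -> e x z.
Proof.
case=> [[v -> vE]|[v [w [-> vE wE _]]]]; rewrite !inE.
  by move/eqP->; rewrite esy -in_nbh vE set11.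
by case/orP=> /eqP->; rewrite esy -in_nbh ?vE ?wE set22.
Qed.

Lemma unit_clique t x : unit t x -> {in t &, forall z w, z != w -> e z w}.
Proof.
case=> [[v -> vE]|[v [w [-> vE wE _]]]] a b; rewrite !inE.
  by move=> /eqP-> /eqP->; rewrite eqxx.
have evw : e v w by rewrite -in_nbh vE set21.
by case/orP=> /eqP-> /orP[]/eqP->; rewrite ?eqxx // esy.
Qed.

Lemma unit_uniq t x : unit t x -> uniq t.
Proof. by case=> [[v ->]|[v [w [-> _ _ /and3P[vw _ _]]]]] //=; rewrite inE vw. Qed.

Lemma unit_sorted t x : unit t x -> sorted e (rcons t x).
Proof.
case=> [[v -> vE]|[v [w [-> vE wE _]]]] /=; rewrite -!in_nbh ?vE ?wE ?set11 //.
by rewrite set21 set22.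
Qed.

Lemma unit_poor t x z : unit t x -> z \in t -> poor z.
Proof.
case=> [[v -> vE]|[v [w [-> vE wE /and3P[vw vx wx]]]]]; rewrite !inE.
  by move/eqP->; rewrite /poor /split2 /deg vE cards1.
have [dv dw] : deg v = 2 /\ deg w = 2 by rewrite /deg vE wE !cards2 wx vx.
have evw : e v w by rewrite -in_nbh vE set21.
case/orP=> /eqP->; rewrite /poor /split2 ?dv ?dw eqxx /=; apply/forallPn.
  by exists w; rewrite evw dw.
by exists v; rewrite esy evw dv.
Qed.

Lemma unit_not_poor t x : unit t x -> ~~ poor x /\ ~~ split2 x.
Proof.
move=> tx; have := unit_deg tx; have := unit_size tx; rewrite /poor /split2.
by move=> ? ?; split; apply/nandP; left; lia.
Qed.

(** If the units shared a vertex [y], its neighbour [z] outside [t'] would be the attachment vertex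
    [x'], but [z] is poor and [x'] is not. *)
Lemma unit_disjoint t x t' x' z :
    unit t x -> unit t' x' -> z \in t -> z \notin t' -> ~~ has (mem t) t'.
Proof.
move=> tx tx' zt zt'; apply/hasPn=> y yt' /=; apply/negP=> yt.
have zy : z != y by apply: contraNneq zt' => ->.
have eyz : e y z by rewrite esy (unit_clique tx).
have zx' := unit_mem_out tx' yt' eyz zt'.
by have := unit_poor tx zt; rewrite zx'; case: (unit_not_poor tx') => /negbTE->.
Qed.

Lemma deg_le3_load v : deg v <= 3 -> load v = 6.
Proof.
move=> dv; rewrite /load [X in _ + X](_ : _ = 0) //; apply/eqP; rewrite cards_eq0.
apply/eqP/setP=> w; rewrite !inE; apply/andP=> -[evw sw].
by have [y [_ _ _ + _]] := split2_other sw evw; rewrite ltnNge dv.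
Qed.

Lemma poor_load v : poor v -> load v = 6.
Proof. by case/andP=> dv _; apply: deg_le3_load; apply: ltnW. Qed.

(** In doubled degrees, a leaf lacks 6 - 2 and the two triangle vertices together lack 12 - 8. *)
Lemma unit_load t x : unit t x -> \sum_(z <- t) load z <= \sum_(z <- t) gain z + 4.
Proof.
move=> tx; have pt := unit_poor tx; case: tx pt.
  move=> [v -> vE] pt; rewrite !big_seq1 poor_load ?pt ?mem_head //.
  by rewrite /gain /deg vE cards1; lia.
move=> [v [w [-> vE wE /and3P[vw vx wx]]]] pt.
rewrite !big_cons !big_nil !poor_load ?pt ?inE ?eqxx ?orbT //.
have [dv dw] : deg v = 2 /\ deg w = 2 by rewrite /deg vE wE !cards2 wx vx.
by rewrite /gain dv dw; lia.
Qed.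

Lemma split2_nbh_lt x :
  0 < #|[set w in nbh x | split2 w]| -> #|[set w in nbh x | split2 w]| < deg x.
Proof.
case/card_gt0P=> v; rewrite !inE => /andP[exv sv].
have [y [_ _ exy _ dy]] := split2_other sv exv.
apply: proper_card; apply/properP; split; first by apply/subsetP=> w /setIdP[].
exists y; first by rewrite in_nbh.
by apply/negP=> /setIdP[_ /andP[/eqP d2 _]]; rewrite d2 in dy.
Qed.

(* Three shared degree-two vertices around a vertex x of degree four have the same
   two neighbours x and y, and removing these leaves four components. *)
Lemma deg4_split2 x : deg x = 4 -> #|[set w in nbh x | split2 w]| <= 2.
Proof.
move=> dx; set S := [set w in nbh x | split2 w]; rewrite leqNgt; apply/negP=> S3.
have /card_gt0P[v0] : 0 < #|S| by apply: leq_trans S3.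
rewrite !inE => /andP[exv0 sv0].
have [y [_ _ exy _ dy]] := split2_other sv0 exv0.
have yS : y \notin S.
  by apply/negP=> /setIdP[_ /andP[/eqP d2 _]]; rewrite d2 in dy.
have nE : nbh x = y |: S.
  apply/esym/eqP; rewrite eqEcard cardsU1 yS -/(deg x) dx [_ <= _]S3 andbT.
  by apply/subsetP=> w /setU1P[->|/setIdP[]] //; rewrite in_nbh.
have SE v : v \in S -> nbh v = [set x; y].
  rewrite 2!inE => /andP[exv sv]; have [y' [vE _ exy' _ dy']] := split2_other sv exv.
  have : y' \in nbh x by rewrite in_nbh.
  rewrite nE => /setU1P[<- //|]; rewrite !inE exy' /= /split2 => /andP[/eqP d2].
  by rewrite d2 in dy'.
(* The edge [xr] is the one to be added; being incident with [x], it disappears with [x]. *)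
have [r rN] : exists r, r \notin x |: nbh x.
  have : ~~ (setT \subset x |: nbh x).
    apply/negP=> /subset_leq_card; rewrite cardsT cardsU1 -/(deg x) dx.
    by move: T_gt7; clear; case: (x \notin _); lia.
  by case/subsetPn=> r _; exists r.
move: rN; rewrite in_setU1 negb_or in_nbh => /andP[rx nxr].
have xr : x != r by rewrite eq_sym.
have xy := edge_neq eirr exy.
have T_gt0 : 0 < #|T| by apply: leq_trans T_gt7.
have /(traceableP _ T_gt0)[s spn] := mnt.2 x r xr nxr.
have gsym := add_edge_sym x r esy.
have [p1 [p2 [p3 [srt unq full]]]] := spanning_split2 gsym spn xy.
(* Away from [x] and [y] a vertex of [S] is isolated, so it fills a piece alone. Three pieces cannot
   hold three vertices of [S] and [r] as well. *)
have piece p : sorted (add_edge e x r) p -> x \notin p -> y \notin p ->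
    #|[set v in S | v \in p]| <= (r \notin p).
  move=> psrt xp yp; case: (set_0Vmem [set v in S | v \in p]) => [->|[v]].
    by rewrite cards0.
  rewrite inE => /andP[vS vp].
  have out w : w \in p -> add_edge e x r v w -> False.
    move=> wp; have vN : v \in nbh x by rewrite nE in_setU1 vS orbT.
    rewrite add_edgeNl; first last.
    - by apply: contraNneq nxr => <-; rewrite -in_nbh.
    - by rewrite in_nbh in vN; rewrite eq_sym (edge_neq eirr vN).
    rewrite -in_nbh SE // => /set2P[] wE; first by rewrite -wE wp in xp.
    by rewrite -wE wp in yp.
  have pv w : w \in p -> w = v.
    move=> wp; apply/set1P; rewrite (@sorted_mem_const _ _ [set v] p psrt _ w v) ?set11 //.
    move=> a b ap bp rab; rewrite !inE; case: (eqVneq a v) => [av|_].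
      by case: (out b) => //; rewrite -av.
    by case: (eqVneq b v) => // bv; case: (out a) => //; rewrite gsym -bv.
  have -> : r \notin p.
    apply/negP=> /pv rv; case/negP: nxr; rewrite rv -in_nbh nE.
    by rewrite in_setU1 vS orbT.
  have <- : #|[set v]| = true by rewrite cards1.
  by apply: subset_leq_card; apply/subsetP=> w /setIdP[_ /pv->]; rewrite set11.
have := srt; rewrite sorted_cat_cons => /andP[s1 s23].
have s3 : sorted (add_edge e x r) p3.
  by move: s23; rewrite cat_path /= => /and3P[_ _ /path_sorted].
have s2 : sorted (add_edge e x r) p2.
  by move: s23; rewrite cat_path => /andP[/path_sorted].
have {}s1 : sorted (add_edge e x r) p1.
  exact: sorted_rconsW s1.
move: unq; rewrite cat_uniq /= cat_uniq /= mem_cat inE !negb_or.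
case/and5P=> _; rewrite has_cat /= !negb_or.
case/and4P=> x1 _ y1 _ /and3P[x2 _ x3] _ /and3P[/andP[y2 _] y3 _].
have := leq_add (piece p1 s1 x1 y1) (leq_add (piece p2 s2 x2 y2) (piece p3 s3 x3 y3)).
have : #|S| <= #|[set v in S | v \in p1]| +
    (#|[set v in S | v \in p2]| + #|[set v in S | v \in p3]|).
  apply: leq_trans (leq_add (leqnn _) (leq_card_setU _ _)).
  apply: leq_trans (leq_card_setU _ _); apply: subset_leq_card; apply/subsetP=> v vS.
  have vN : v \in nbh x by rewrite nE in_setU1 vS orbT.
  have vx : v != x by rewrite eq_sym (edge_neq eirr) // -in_nbh.
  have vy : v != y by apply: contraNneq yS => <-.
  have := full v; rewrite !inE -in_nbh vN /= !(mem_cat, inE) (negbTE vx) (negbTE vy) /=.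
  by move: vS; rewrite !inE => /andP[_ ->].
have : r \in p1 ++ p2 ++ p3.
  have ry : r != y by apply: contraNneq nxr => ->.
  by have := full r; rewrite !(mem_cat, inE) (negbTE rx) (negbTE ry).
rewrite !mem_cat; move: S3; clear.
by case: (r \in p1); case: (r \in p2); case: (r \in p3) => //=; lia.
Qed.

(** Degree three gives nothing away and degree four at most two units; for degree d >= 5 the load is
    at most 6 + (d - 1) <= 2d. *)
Lemma load_gain x : ~~ poor x -> load x <= gain x.
Proof.
rewrite /poor negb_and negbK -leqNgt => /orP[d3|sx]; last first.
  have /andP[/eqP d2 _] := sx.
  by rewrite deg_le3_load ?d2 // /gain d2 sx.
have := @split2_nbh_lt x; have := @deg4_split2 x; have := @deg_le3_load x.
by rewrite /gain /load; lia.
Qed.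

Lemma sum_load : \sum_x load x + 2 * \sum_x deg x = \sum_x gain x + 6 * #|T|.
Proof.
rewrite /load /gain 2!big_split /= big_distrr /= sum_nat_const mulnC.
(* Double counting: each [split2] vertex is seen from its two neighbours, so transfers cancel in the
   total. *)
suff -> : \sum_x #|[set w in nbh x | split2 w]| = \sum_w 2 * split2 w.
  rewrite addnC addnCA addnC; congr addn; by rewrite addnC.
under eq_bigr => x _ do rewrite -sum1dep_card big_mkcond.
rewrite exchange_big /=; apply: eq_bigr => w _.
case sw: (split2 w); last by rewrite big1 // => x _; rewrite andbF.
have /andP[/eqP <- _] := sw; rewrite muln1 degE; apply: eq_bigr => x _.
by rewrite andbT in_nbh esy; case: (e w x).
Qed.

(** Twice the final bound would allow a deficit of 4; by parity 5 is enough. *)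
Lemma degree_sum_of_load t :
    uniq t -> (forall v, v \notin t -> ~~ poor v) ->
    \sum_(v <- t) load v <= \sum_(v <- t) gain v + 5 ->
  3 * #|T| <= \sum_v deg v + 2.
Proof.
move=> tu tp tl; suff : \sum_x load x <= \sum_x gain x + 5 by have := sum_load; lia.
rewrite (bigID (mem t)) [X in _ <= X + 5](bigID (mem t)) /= -!big_uniq //.
have : \sum_(v | v \notin t) load v <= \sum_(v | v \notin t) gain v.
  by apply: leq_sum => v /tp; apply: load_gain.
by move=> h; apply: leq_trans (leq_add tl h) _; rewrite addnAC.
Qed.

(** * Several units when three pendants are excluded *)

Hypothesis no3 : forall (A : 'I_3 -> {set T}) (x : 'I_3 -> T), ~ three_pendants e A x.

Lemma no_three_pendants A1 x1 A2 x2 A3 x3 :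
    pendant e A1 x1 -> pendant e A2 x2 -> pendant e A3 x3 ->
    [disjoint A1 & A2] -> [disjoint A1 & A3] -> [disjoint A2 & A3] ->
    all (fun x => [&& x \notin A1, x \notin A2 & x \notin A3]) [:: x1; x2; x3] ->
  False.
Proof.
move=> pA1 pA2 pA3 d12 d13 d23 /and4P[/and3P[x11 x12 x13] /and3P[x21 x22 x23]].
move=> /and3P[x31 x32 x33] _.
pose A (i : 'I_3) := nth set0 [:: A1; A2; A3] i.
pose x (i : 'I_3) := nth x1 [:: x1; x2; x3] i.
apply: (@no3 A x); rewrite /A /x; split.
- by case=> [[|[|[|i]]] //= _].
- by case=> [[|[|[|i]]] //= ?]; case=> [[|[|[|j]]] //= ?] _ //; rewrite disjoint_sym.
- by case=> [[|[|[|i]]] //= ?]; case=> [[|[|[|j]]] //= ?].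
Qed.

Lemma unit_attach_notin t x t' x' : unit t x -> unit t' x' -> x \notin t'.
Proof.
move=> tx tx'; apply/negP=> /(unit_poor tx') px.
by have [] := unit_not_poor tx; rewrite px.
Qed.

Lemma disjoint_seq t t' : ~~ has (mem t) t' -> [disjoint [set z in t] & [set z in t']].
Proof.
move=> /hasPn tt'; rewrite -setI_eq0; apply/eqP/setP=> z; rewrite !inE.
by apply/andP=> -[zt /tt']; rewrite /= zt.
Qed.

(** With a common attachment vertex, all the remaining vertices would form a third pendant at it. *)
Lemma units_attach_neq t1 x1 t2 x2 :
  unit t1 x1 -> unit t2 x2 -> ~~ has (mem t1) t2 -> x1 != x2.
Proof.
move=> u1 u2 d12; apply/eqP=> x12; subst x2.
have [/andP[_ s1] /andP[_ s2]] := (unit_size u1, unit_size u2).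
set R := ~: [set z in x1 :: t1 ++ t2].
have R0 : R != set0.
  apply/negP=> /eqP RE; have sz := card_size (x1 :: t1 ++ t2).
  rewrite -cardsE -[[set z in _]]setCK -/R RE setC0 cardsT /= size_cat in sz.
  by have := leq_trans T_gt7 sz; lia.
have pR : pendant e R x1.
  split=> //; first by rewrite !inE eqxx.
  move=> a; rewrite inE in_set in_cons mem_cat !negb_or => /and3P[ax a1 a2] b eab.
  rewrite in_setU1 inE in_set in_cons mem_cat !negb_or.
  case: (eqVneq b x1) => //= bx; apply/andP; split.
    apply: contra a1 => b1; rewrite esy in eab; apply: contraR ax => a1.
    by rewrite (unit_mem_out u1 b1 eab a1).
  apply: contra a2 => b2; rewrite esy in eab; apply: contraR ax => a2.
  by rewrite (unit_mem_out u2 b2 eab a2).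
have dR t : {subset t <= t1 ++ t2} -> [disjoint [set z in t] & R].
  move=> tsub; rewrite -setI_eq0; apply/eqP/setP=> z; rewrite !inE.
  by apply/negbTE/negP => /andP[/tsub ->]; rewrite orbT.
apply: (no_three_pendants (unit_pendant u1) (unit_pendant u2) pR).
- exact: disjoint_seq.
- by apply: dR => z; rewrite mem_cat => ->.
- by apply: dR => z; rewrite mem_cat => ->; rewrite orbT.
- by rewrite /= !inE eqxx (unit_attach_notin u1 u1) (unit_attach_notin u1 u2).
Qed.

Lemma spans_sym H a b : spans e H a b -> spans e H b a.
Proof.
case=> p [pth lst unq pE]; exists (rev (belast a p)).
have rE : b :: rev (belast a p) = rev (a :: p) by rewrite (lastI a p) rev_rcons lst.
split.
- have : sorted e (rev (a :: p)) by rewrite sorted_rev_sym.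
  by rewrite -rE.
- by case: (p) lst => [|c q] //= lst; rewrite rev_cons last_rcons.
- by rewrite rE rev_uniq.
- by move=> w; rewrite rE mem_rev.
Qed.

Lemma spans_mem H a b : spans e H a b -> a \in H /\ b \in H.
Proof. by case=> p [_ <- _ pE]; rewrite -!pE mem_head mem_last. Qed.

Lemma spans_card H a p : (forall w, (w \in a :: p) = (w \in H)) -> uniq (a :: p) ->
  #|H| = size (a :: p).
Proof. by move=> pE unq; rewrite -(eq_card pE) (card_uniqP unq). Qed.

Lemma spans_refl H a : spans e H a a -> #|H| = 1.
Proof.
case=> p [_ lst unq pE]; rewrite (@spans_card H a p) //.
case/lastP: p lst unq {pE} => // p c; rewrite last_rcons => ->.
by rewrite /= mem_rcons mem_head.
Qed.

Lemma spans_nbr H a b v : spans e H a b -> 1 < #|H| -> v \in H ->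
  exists2 w, w \in H & e v w.
Proof.
case=> p [pth _ unq pE]; rewrite (@spans_card H a p) // => sz; rewrite -pE => vp.
have [p1 [p2 def_p]] := mem_split vp.
have : sorted e (a :: p) by [].
case: p2 def_p => [|w p2] def_p; rewrite def_p sorted_cat_cons.
  case/lastP: p1 def_p => [|p1 w] def_p; first by rewrite def_p in sz.
  rewrite -!cats1 -catA sorted_cat_cons => /andP[/andP[_ /= /andP[ewv _]] _].
  by exists w; rewrite 1?esy // -pE def_p !(mem_cat, mem_rcons) mem_head.
by move=> /= /and3P[_ evw _]; exists w; rewrite // -pE def_p mem_cat !inE eqxx !orbT.
Qed.

Lemma spans_next H a b c : spans e H a b -> a != b ->
    (forall w, w \in H -> e a w -> w = c) ->
  exists p, [/\ path e c p, last c p = b, uniq [:: a, c & p] &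
               forall w, (w \in [:: a, c & p]) = (w \in H)].
Proof.
move=> [[|c' p] [pth lst unq pE]] ab nc; first by rewrite -lst eqxx in ab.
have /= /andP[eac pth'] := pth.
have cc : c' = c by apply: nc; rewrite // -pE !inE eqxx orbT.
by subst c'; exists p.
Qed.

Lemma spans_next_end H a b : spans e H a b -> a != b ->
  (forall w, w \in H -> e a w -> w = b) -> #|H| = 2.
Proof.
move=> sp ab nb; have [p [_ lst unq pE]] := spans_next sp ab nb.
rewrite (@spans_card H a (b :: p)) //; case/lastP: p lst unq {pE} => // p c.
by rewrite last_rcons => ->; rewrite /= mem_rcons mem_head /= andbF.
Qed.

Lemma spans_next2 H a b c : spans e H a b -> a != b -> c != b ->
    (forall w, w \in H -> e a w -> w = c) -> (forall w, w \in H -> e b w -> w = c) ->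
  #|H| = 3.
Proof.
move=> sp ab cb ac bc; have [p [pth lst unq pE]] := spans_next sp ab ac.
rewrite (@spans_card H a (c :: p)) //.
case/lastP: p lst pth unq pE => [/= cb'|p b']; first by rewrite cb' eqxx in cb.
rewrite last_rcons => ->; rewrite rcons_path => /andP[_ elb] unq pE.
have lc : last c p = c.
  apply: bc; rewrite 1?esy // -pE inE -rcons_cons mem_rcons inE mem_last !orbT //.
case/lastP: p lc unq {pE elb} => // p d; rewrite last_rcons => ->.
by rewrite /= !(mem_rcons, inE) eqxx !orbT /= andbF.
Qed.

Definition two_units t1 x1 t2 x2 H :=
  [/\ unit t1 x1, unit t2 x2, ~~ has (mem t1) t2
    & forall z, (z \in H) = [&& z != x1, z != x2, z \notin t1 & z \notin t2]].

Lemma two_units_sym t1 x1 t2 x2 H : two_units t1 x1 t2 x2 H -> two_units t2 x2 t1 x1 H.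
Proof.
case=> u1 u2 d12 HE; split=> //; first by rewrite has_sym.
by move=> z; rewrite HE andbCA [(z \notin t1) && _]andbC.
Qed.

(** * Two units and spanning paths of the remaining set [H] *)

Section TwoUnits.

Variables (t1 : seq T) (x1 : T) (t2 : seq T) (x2 : T) (H : {set T}).
Hypothesis tu : two_units t1 x1 t2 x2 H.

Lemma tu_neq : x1 != x2.
Proof. by case: tu => u1 u2 d12 _; apply: units_attach_neq d12. Qed.

Lemma tu_uniq : uniq [:: x1, x2 & t1 ++ t2].
Proof.
have [u1 u2 d12 HE] := tu; rewrite /= inE !mem_cat cat_uniq !negb_or tu_neq.
rewrite (unit_attach_notin u1 u1) (unit_attach_notin u1 u2).
rewrite (unit_attach_notin u2 u1) (unit_attach_notin u2 u2).
by rewrite (unit_uniq u1) (unit_uniq u2) d12.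
Qed.

Lemma tu_card : #|H| + size t1 + size t2 + 2 = #|T|.
Proof.
have [u1 u2 d12 HE] := tu.
have <- : #|~: [set z in [:: x1, x2 & t1 ++ t2]]| = #|H|.
  by apply: eq_card => z; rewrite HE !inE mem_cat !negb_or.
have := cardsC [set z in [:: x1, x2 & t1 ++ t2]].
by rewrite cardsE (card_uniqP tu_uniq) /= size_cat; lia.
Qed.

Lemma tu_card_ge2 : 1 < #|H|.
Proof.
have [u1 u2 _ _] := tu; have := tu_card.
have [/andP[_ s1] /andP[_ s2]] := (unit_size u1, unit_size u2).
by move: T_gt7 s1 s2; clear; lia.
Qed.

(** Otherwise [t1], [x1], the path through [H], [x2] and the reverse of [t2] form a hamiltonian
    path. *)
Lemma tu_no_spans y1 y2 : e x1 y1 -> e x2 y2 -> ~ spans e H y1 y2.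
Proof.
have [u1 u2 d12 HE] := tu.
move=> e1 e2 [p [pth lst unq pE]]; apply: mnt.1.
have T_gt0 : 0 < #|T| by apply: leq_trans T_gt7.
apply/(traceableP _ T_gt0).
exists (t1 ++ x1 :: (y1 :: p) ++ x2 :: rev t2); split.
- rewrite sorted_cat_cons (unit_sorted u1) /= e1 cat_path pth /= lst esy e2 /=.
  have : sorted e (rev (rcons t2 x2)) by rewrite sorted_rev_sym // (unit_sorted u2).
  by rewrite rev_rcons.
- rewrite (perm_uniq (_ : perm_eq _ ([:: x1, x2 & t1 ++ t2] ++ (y1 :: p)))).
    rewrite cat_uniq unq andbT; apply/andP; split; last first.
      apply/hasPn=> z; rewrite pE HE => /and4P[z1 z2 z3 z4].
      by rewrite !inE mem_cat !negb_or z1 z2 z3.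
    exact: tu_uniq.
  apply/permP=> f; rewrite !(count_cat, count_rev) /=.
  rewrite !(count_cat, count_rev) /= count_rev; lia.
- move=> z; rewrite mem_cat (in_cons x1) mem_cat (in_cons x2) mem_rev pE HE.
  by case: (z \in t1); case: (z \in t2); case: eqP => _; case: eqP => _; rewrite ?orbT.
Qed.

Lemma tu_spans_add u v :
    u != v -> ~~ e u v -> u \notin t1 ++ t2 -> v \notin t1 ++ t2 ->
  exists y1 y2, [/\ add_edge e u v x1 y1, add_edge e u v x2 y2
                  & spans (add_edge e u v) H y1 y2].
Proof.
move=> uv nuv; rewrite !mem_cat !negb_or => /andP[ut1 ut2] /andP[vt1 vt2].
have [u1 u2 d12 HE] := tu.
have := @two_pendants_spans T (add_edge e u v) [set z in t1] [set z in t2] x1 x2.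
have HH : ~: (x1 |: (x2 |: [set z in t1] :|: [set z in t2])) = H.
  by apply/setP=> z; rewrite HE !inE !negb_or andbA -!andbA.
rewrite HH; apply.
- exact: add_edge_sym.
- by apply: pendant_add_edge (unit_pendant u1) _; rewrite !inE ut1 vt1.
- by apply: pendant_add_edge (unit_pendant u2) _; rewrite !inE ut2 vt2.
- exact: tu_neq.
- by rewrite inE (unit_attach_notin u1 u2).
- by rewrite inE (unit_attach_notin u2 u1).
- exact: disjoint_seq.
- by rewrite -card_gt0; apply: leq_trans tu_card_ge2.
- exact: mnt.2.
Qed.

Lemma tu_notin_H : (x1 \notin H) * (x2 \notin H).
Proof. by case: tu => _ _ _ HE; rewrite !HE !eqxx /= andbF. Qed.

Lemma tu_spans_real x v y1 y2 :
  x \notin H -> spans (add_edge e x v) H y1 y2 -> spans e H y1 y2.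
Proof.
move=> xH [p [pth lst unq pE]]; exists p; split=> //.
apply: (@sub_in_path T (mem H)) pth; last by apply/allP=> z; rewrite pE.
move=> a b aH bH; rewrite /add_edge => /or3P[//|/andP[/eqP ax _]|/andP[_ /eqP bx]].
  by rewrite -ax [a \in H]aH in xH.
by rewrite -bx [b \in H]bH in xH.
Qed.

(** Adding [x1 x2] creates no new neighbour in [H], so the crossing of [H] would already exist. *)
Lemma tu_adj : e x1 x2.
Proof.
have [u1 u2 d12 HE] := tu; apply/negPn/negP=> n12.
have [||y1 [y2 [e1 e2 sp]]] := tu_spans_add tu_neq n12.
- by rewrite mem_cat negb_or (unit_attach_notin u1 u1) (unit_attach_notin u1 u2).
- by rewrite mem_cat negb_or (unit_attach_notin u2 u1) (unit_attach_notin u2 u2).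
have {}sp := tu_spans_real tu_notin_H.1 sp.
have [y1H y2H] := spans_mem sp.
move: y1H y2H; rewrite !HE => /and4P[y11 y12 _ _] /and4P[y21 y22 _ _].
rewrite add_edgeNr // in e1; rewrite add_edgeNr // in e2.
exact: tu_no_spans sp.
Qed.

(** Once [x1 y] is added, the hamiltonian path must enter [H] through this edge, by [tu_no_spans];
    inside [H] it uses old edges only. *)
Lemma tu_spans y : y \in H -> ~~ e x1 y -> exists y2, e x2 y2 /\ spans e H y y2.
Proof.
have [u1 u2 d12 HE] := tu; move=> yH n1.
have := yH; rewrite HE => /and4P[yx1 yx2 yt1 yt2].
have [||||y1 [y2 [e1 e2 sp]]] := @tu_spans_add x1 y.
- by rewrite eq_sym.
- by [].
- by rewrite mem_cat negb_or (unit_attach_notin u1 u1) (unit_attach_notin u1 u2).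
- by rewrite mem_cat negb_or yt1.
have {}sp := tu_spans_real tu_notin_H.1 sp.
have [y1H y2H] := spans_mem sp.
move: y1H y2H; rewrite !HE => /and4P[y11 y12 _ _] /and4P[y21 y22 _ _].
rewrite add_edgeNl // 1?eq_sym // ?tu_neq // in e2.
case: (eqVneq y1 y) => [yy|yy1]; first by subst y1; exists y2.
rewrite add_edgeNr // in e1.
by case: (tu_no_spans e1 e2 sp).
Qed.

Lemma tu_nbhE : nbh x1 = x2 |: ([set z in t1] :|: nbh x1 :&: H).
Proof.
have [u1 u2 d12 HE] := tu; apply/setP=> z; rewrite !inE.
apply/idP/or3P=> [e1|[/eqP->|zt1|/andP[]//]]; [|exact: tu_adj|exact: unit_adj zt1].
rewrite e1 HE; case: (eqVneq z x2) => [_|zx2]; first by constructor 1.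
case: (boolP (z \in t1)) => [_|zt1]; first by constructor 2.
constructor 3; rewrite eq_sym (edge_neq eirr e1) /=.
apply/negP=> zt2; rewrite esy in e1.
have := unit_mem_out u2 zt2 e1 (unit_attach_notin u1 u2) => /eqP.
by rewrite (negbTE tu_neq).
Qed.

Lemma tu_deg : deg x1 = size t1 + 1 + #|nbh x1 :&: H|.
Proof.
have [u1 u2 d12 HE] := tu.
rewrite /deg [in LHS]tu_nbhE cardsU1 !inE negb_or (unit_attach_notin u2 u1).
rewrite (negbTE tu_notin_H.2) andbF.
rewrite cardsU cardsE (card_uniqP (unit_uniq u1)).
have -> : [set z in t1] :&: (nbh x1 :&: H) = set0.
  by apply/setP=> z; rewrite !inE HE; case: (z \in t1); rewrite ?andbF.
by rewrite cards0 subn0 addnA [1 + _]addnC.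
Qed.

Lemma tu_nbh_gt0 : 0 < #|nbh x1 :&: H|.
Proof. by have [u1 _ _ _] := tu; have := unit_deg u1; rewrite tu_deg; lia. Qed.

Lemma tu_split2_H v : split2 v -> e x1 v -> v \in nbh x1 :&: H.
Proof.
have [u1 u2 d12 HE] := tu; move=> sv e1.
have : v \in nbh x1 by rewrite in_nbh.
rewrite {1}tu_nbhE in_setU1 in_setU inE => /or3P[/eqP vx2|/(unit_poor u1)|//].
  by have [_] := unit_not_poor u2; rewrite -vx2 sv.
by rewrite /poor sv andbF.
Qed.

Lemma tu_split2_le : #|[set w in nbh x1 | split2 w]| <= #|nbh x1 :&: H|.
Proof.
apply: subset_leq_card; apply/subsetP=> w /setIdP[]; rewrite in_nbh => ew sw.
exact: tu_split2_H.
Qed.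

Lemma tu_split2_other v : split2 v -> e x1 v -> ~~ e x2 v ->
  exists y, [/\ nbh v = [set x1; y], y \in nbh x1 :&: H, ~~ split2 y & y != v].
Proof.
have [u1 u2 d12 HE] := tu; move=> sv e1 ne2.
have [y [vE x1y e1y _ dy]] := split2_other sv e1; exists y; split=> //.
- have evy : e v y by rewrite -in_nbh vE set22.
  have : y \in nbh x1 by rewrite in_nbh.
  rewrite {1}tu_nbhE in_setU1 in_setU inE => /or3P[/eqP yx2|yt1|//].
    by rewrite esy -yx2 evy in ne2.
  have vt1 : v \notin t1 by apply/negP=> /(unit_poor u1); rewrite /poor sv andbF.
  rewrite esy in evy; have vx1 := unit_mem_out u1 yt1 evy vt1.
  by rewrite vx1 eirr in e1.
- by apply/negP=> /andP[/eqP d2 _]; rewrite d2 in dy.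
- by apply: contraTneq dy => ->; case/andP: sv => /eqP->.
Qed.

Lemma tu_split2_lt v : split2 v -> e x1 v -> ~~ e x2 v ->
  #|[set w in nbh x1 | split2 w]| < #|nbh x1 :&: H|.
Proof.
move=> sv e1 ne2; have [y [_ yN ny _]] := tu_split2_other sv e1 ne2.
apply: proper_card; apply/properP; split.
  by apply/subsetP=> w /setIdP[]; rewrite in_nbh => ew sw; apply: tu_split2_H.
by exists y => //; rewrite inE (negbTE ny) andbF.
Qed.

(** Such a [v] has no neighbour in [H], so [H] has no spanning path and [tu_spans] leaves no
    nonneighbour of [x1] in [H]. *)
Lemma tu_common_split2 v : split2 v -> e x1 v -> e x2 v -> nbh x1 :&: H = H.
Proof.
move=> sv e1 e2; have [_ _ _ HE] := tu; apply/setIidPr/subsetP=> y yH.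
rewrite in_nbh; apply/negPn/negP=> /(tu_spans yH)[y2 [_ sp]].
have /setIP[_ vH] := tu_split2_H sv e1.
have [w wH evw] := spans_nbr sp tu_card_ge2 vH.
have [y' [vE _ _ _ _]] := split2_other sv e1.
have : x2 \in nbh v by rewrite in_nbh esy.
rewrite vE !inE eq_sym (negbTE tu_neq) /= => /eqP x2y.
rewrite -in_nbh vE -x2y !inE in evw.
by case/orP: evw => /eqP wx; move: wH; rewrite wx ?(negbTE tu_notin_H.1) ?(negbTE tu_notin_H.2).
Qed.

End TwoUnits.

(** * Attachment vertices with few neighbours in [H] *)

Lemma tu_two_nbrs t1 x1 t2 x2 H v :
    two_units t1 x1 t2 x2 H -> #|nbh x1 :&: H| = 2 ->
  split2 v -> e x1 v -> ~~ e x2 v -> #|H| <= 2.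
Proof.
move=> tu N2 sv e1 ne2; have /setIP[_ vH] := tu_split2_H tu sv e1.
have [y [vE yN _ yv]] := tu_split2_other tu sv e1 ne2.
have vN : v \in nbh x1 :&: H by rewrite inE in_nbh e1.
have NE : nbh x1 :&: H = [set v; y].
  apply/esym/eqP; rewrite eqEcard N2 cards2 eq_sym yv andbT.
  by apply/subsetP=> w /set2P[]->.
(* The spanning path from [v] ends at [v] or [y], and [y] is the only neighbour of [v] in [H]. *)
have [y1 [ey1 sp]] := tu_spans (two_units_sym tu) vH ne2.
have : y1 \in nbh x1 :&: H by rewrite inE in_nbh ey1; case: (spans_mem sp).
rewrite NE => /set2P[] y1E; rewrite {}y1E in sp; first by rewrite (spans_refl sp).
rewrite (spans_next_end sp) 1?eq_sym // => w wH; rewrite -in_nbh vE.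
by case/set2P=> // wx; rewrite wx (negbTE (tu_notin_H tu).1) in wH.
Qed.

(** Otherwise [tu_spans] gives a spanning path of [H] from [z] to a neighbour of [x1], that is to
    [z] itself. *)
Lemma tu_single t1 x1 t2 x2 H z :
    two_units t1 x1 t2 x2 H -> nbh x1 :&: H = [set z] -> e x2 z.
Proof.
move=> tu NE; have /setIP[e1z zH] : z \in nbh x1 :&: H by rewrite NE set11.
apply/negPn/negP=> /(tu_spans (two_units_sym tu) zH)[y1 [ey1 sp]].
have : y1 \in nbh x1 :&: H by rewrite inE in_nbh ey1; case: (spans_mem sp).
rewrite NE => /set1P y1z; rewrite y1z in sp.
by have := tu_card_ge2 tu; rewrite (spans_refl sp).
Qed.

(* For such y, adding the edge x1 y gives a spanning path of H from y to y'. *)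
Lemma tu_single_spans t1 x1 t2 x2 H z y :
    two_units t1 x1 t2 x2 H -> nbh x1 :&: H = [set z] -> y \in nbh x2 :&: H -> y != z ->
  exists y', [/\ y' \in nbh x2 :&: H, y' != z, y' != y & spans e H y y'].
Proof.
move=> tu NE /setIP[]; rewrite in_nbh => e2y yH yz.
have /setIP[e1z _] : z \in nbh x1 :&: H by rewrite NE set11.
rewrite in_nbh in e1z.
have n1y : ~~ e x1 y.
  by apply: contra yz => e1y; rewrite -in_set1 -NE inE in_nbh e1y.
have [y' [e2 sp]] := tu_spans tu yH n1y; exists y'; split=> //.
- by rewrite inE in_nbh e2; case: (spans_mem sp).
- apply/eqP=> y'z; rewrite y'z in sp.
  exact: tu_no_spans tu _ _ e1z e2y (spans_sym sp).
- apply/eqP=> y'y; rewrite y'y in sp.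
  by have := tu_card_ge2 tu; rewrite (spans_refl sp).
Qed.

Lemma tu_single_ge3 t1 x1 t2 x2 H :
    two_units t1 x1 t2 x2 H -> #|nbh x1 :&: H| = 1 -> 1 < #|nbh x2 :&: H| ->
  2 < #|nbh x2 :&: H|.
Proof.
move=> tu /eqP/cards1P[z NE] N2.
have /setIP[_ zH] : z \in nbh x1 :&: H by rewrite NE set11.
have zN : z \in nbh x2 :&: H by rewrite inE in_nbh (tu_single tu NE).
have /card_gt0P[y] : 0 < #|(nbh x2 :&: H) :\ z| by move: N2; rewrite (cardsD1 z) zN.
case/setD1P=> yz yN; have [y' [y'N y'z y'y _]] := tu_single_spans tu NE yN yz.
have <- : #|z |: [set y; y']| = 3.
  rewrite cardsU1 cards2 !inE negb_or [z == y]eq_sym [z == y']eq_sym [y == y']eq_sym.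
  by rewrite yz y'z y'y.
by apply: subset_leq_card; apply/subsetP=> w; rewrite in_setU1 => /predU1P[->|/set2P[]->].
Qed.

(** Both [split2] neighbours of [x2] have [z] as only neighbour in [H], so the spanning path joining
    them has three vertices. *)
Lemma tu_single_three t1 x1 t2 x2 H :
    two_units t1 x1 t2 x2 H -> (forall v, split2 v -> e x1 v -> ~~ e x2 v) ->
    #|nbh x1 :&: H| = 1 -> #|nbh x2 :&: H| = 3 ->
    #|[set w in nbh x2 | split2 w]| = 2 ->
  #|H| <= 3.
Proof.
move=> tu nocommon /eqP/cards1P[z NE] N3; set S := [set w in _ | _] => S2.
have tu' := two_units_sym tu.
have /setIP[] : z \in nbh x1 :&: H by rewrite NE set11.
rewrite in_nbh => e1z zH; have e2z := tu_single tu NE.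
have zN : z \in nbh x2 :&: H by rewrite inE in_nbh e2z.
have nz : ~~ split2 z by apply: contraL e2z => /nocommon; apply.
have SE : (nbh x2 :&: H) :\ z = S.
  apply/esym/eqP; rewrite eqEcard S2 andbC; apply/andP; split.
    by move: N3; rewrite (cardsD1 z) zN add1n => -[->].
  apply/subsetP=> w /setIdP[]; rewrite in_nbh => e2w sw.
  rewrite in_setD1 (tu_split2_H tu') // andbT.
  by apply: contraNneq nz => <-.
have Snbr v w : v \in S -> w \in H -> e v w -> w = z.
  move=> vS wH evw; have /setIdP[] := vS; rewrite in_nbh => e2v sv.
  have n1v : ~~ e x1 v by apply: contraL e2v; apply: nocommon.
  have [y [vE yN ny _]] := tu_split2_other tu' sv e2v n1v.
  have : y \notin S by apply/negP=> /setIdP[_ sy]; rewrite sy in ny.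
  rewrite -SE in_setD1 yN andbT negbK => /eqP yz.
  move: evw; rewrite -in_nbh vE yz => /set2P[wx|//].
  by rewrite wx (negbTE (tu_notin_H tu).2) in wH.
have /card_gt0P[v vS] : 0 < #|S| by rewrite S2.
have := vS; rewrite -SE => /setD1P[vz vN].
have [y' [y'N y'z y'v sp]] := tu_single_spans tu NE vN vz.
have y'S : y' \in S by rewrite -SE in_setD1 y'z.
rewrite (spans_next2 sp (_ : v != y') (_ : z != y')) 1?eq_sym // => w.
  exact: Snbr.
exact: Snbr.
Qed.

(** Both neighbours would be the same [z], and [H :\ z] would be a third pendant, attached at
    [z]. *)
Lemma tu_not_singles t1 x1 t2 x2 H :
    two_units t1 x1 t2 x2 H -> #|nbh x1 :&: H| = 1 -> #|nbh x2 :&: H| = 1 -> False.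
Proof.
move=> tu /eqP/cards1P[z N1] /eqP/cards1P[z' N2]; have [u1 u2 d12 HE] := tu.
have e2z := tu_single tu N1.
have /setIP[_ zH] : z \in nbh x1 :&: H by rewrite N1 set11.
have zz' : z = z' by apply/set1P; rewrite -N2 inE in_nbh e2z.
subst z'; have := zH; rewrite HE => /and4P[zx1 zx2 zt1 zt2].
have p3 : pendant e (H :\ z) z.
  split.
  - by have := tu_card_ge2 tu; rewrite -card_gt0 (cardsD1 z) zH.
  - by rewrite in_setD1 eqxx.
  - move=> a /setD1P[az aH] b eab; rewrite in_setU1 in_setD1.
    case: (eqVneq b z) => //= _.
    have := aH; rewrite HE => /and4P[ax1 ax2 at1 at2]; rewrite esy in eab.
    rewrite HE; apply/and4P; split.
    + by apply: contra az => /eqP bx; rewrite -in_set1 -N1 inE in_nbh aH -bx eab.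
    + by apply: contra az => /eqP bx; rewrite -in_set1 -N2 inE in_nbh aH -bx eab.
    + by apply: contra ax1 => b1; rewrite (unit_mem_out u1 b1 eab).
    + by apply: contra ax2 => b2; rewrite (unit_mem_out u2 b2 eab).
apply: (no_three_pendants (unit_pendant u1) (unit_pendant u2) p3).
- exact: disjoint_seq.
- rewrite -setI_eq0; apply/eqP/setP=> w; rewrite !inE HE.
  by case: (w \in t1); rewrite ?andbF.
- rewrite -setI_eq0; apply/eqP/setP=> w; rewrite !inE HE.
  by case: (w \in t2); rewrite ?andbF.
- rewrite /= !in_setD1 (negbTE (tu_notin_H tu).1) (negbTE (tu_notin_H tu).2) !inE eqxx !andbF.
  rewrite (unit_attach_notin u1 u1) (unit_attach_notin u1 u2).
  by rewrite (unit_attach_notin u2 u1) (unit_attach_notin u2 u2) zt1 zt2.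
Qed.

Lemma two_units_load t1 x1 t2 x2 :
    unit t1 x1 -> unit t2 x2 -> ~~ has (mem t1) t2 ->
  uniq [:: x1, x2 & t1 ++ t2] /\
    \sum_(v <- [:: x1, x2 & t1 ++ t2]) load v <=
  \sum_(v <- [:: x1, x2 & t1 ++ t2]) gain v + 5.
Proof.
move=> u1 u2 d12; pose H := ~: [set z in [:: x1, x2 & t1 ++ t2]].
have tu : two_units t1 x1 t2 x2 H.
  by split=> // z; rewrite !inE mem_cat !negb_or.
have tu' := two_units_sym tu; split; first exact: tu_uniq tu.
rewrite !big_cons !big_cat /=.
have l1 := unit_load u1; have l2 := unit_load u2.
(* The units lack 4 each, so a surplus of 3 brings the deficit down to 5. *)
suff : load x1 + load x2 + 3 <= gain x1 + gain x2.
  move: l1 l2; move: (\sum_(i <- t1) load i) (\sum_(i <- t2) load i).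
  by move: (\sum_(i <- t1) gain i) (\sum_(i <- t2) gain i); clear; lia.
rewrite /load /gain (tu_deg tu) (tu_deg tu').
have c := tu_card tu; have n8 := T_gt7.
have [s1 s2] := (unit_size u1, unit_size u2).
have k1 := tu_split2_le tu; have k2 := tu_split2_le tu'.
have g1 := tu_nbh_gt0 tu; have g2 := tu_nbh_gt0 tu'.
have ns := tu_not_singles tu.
have ge3 := tu_single_ge3 tu; have ge3' := tu_single_ge3 tu'.
case: (boolP [exists v, [&& split2 v, e x1 v & e x2 v]]) => [/existsP[v /and3P[sv e1 e2]]|].
  (* Here both attachment vertices are adjacent to all of [H], which is ample. *)
  move: k1 k2; rewrite (tu_common_split2 tu sv e1 e2) (tu_common_split2 tu' sv e2 e1).
  move: c n8 s1 s2; clear; lia.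
rewrite negb_exists => /forallP nc.
have nocommon v : split2 v -> e x1 v -> ~~ e x2 v.
  by move=> sv e1; have := nc v; rewrite sv e1.
have nocommon' v : split2 v -> e x2 v -> ~~ e x1 v.
  by move=> sv e2; have := nc v; rewrite sv e2 andbT.
have three := tu_single_three tu nocommon; have three' := tu_single_three tu' nocommon'.
have two1 : 0 < #|[set w in nbh x1 | split2 w]| ->
    #|[set w in nbh x1 | split2 w]| < #|nbh x1 :&: H| /\
    (#|nbh x1 :&: H| = 2 -> #|H| <= 2).
  case/card_gt0P=> v /setIdP[]; rewrite in_nbh => e1 sv; have n2 := nocommon v sv e1.
  by split=> [|N2]; [apply: tu_split2_lt tu v sv e1 n2 | apply: tu_two_nbrs tu N2 sv e1 n2].
have two2 : 0 < #|[set w in nbh x2 | split2 w]| ->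
    #|[set w in nbh x2 | split2 w]| < #|nbh x2 :&: H| /\
    (#|nbh x2 :&: H| = 2 -> #|H| <= 2).
  case/card_gt0P=> v /setIdP[]; rewrite in_nbh => e2 sv; have n1 := nocommon' v sv e2.
  by split=> [|N2]; [apply: tu_split2_lt tu' v sv e2 n1 | apply: tu_two_nbrs tu' N2 sv e2 n1].
move: c n8 s1 s2 k1 k2 g1 g2 ns ge3 ge3' three three' two1 two2.
move: #|[set w in nbh x1 | split2 w]| #|[set w in nbh x2 | split2 w]|.
move: #|nbh x1 :&: H| #|nbh x2 :&: H| #|H| #|T| (size t1) (size t2).
clear; move=> h1 h2 h n a1 a2 k1 k2 *.
(* With h neighbours in [H], k of them [split2], and a unit of size a, the surplus is 2a + 2h - 4 -
   k. The tight cases (h, k) = (2, 1), and (3, 2) opposite h = 1, force [H] to be small, so that the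
   units are larger. *)
lia.
Qed.

Lemma degree_sum : 3 * #|T| <= \sum_v deg v + 2.
Proof.
have done_or_poor t : uniq t -> \sum_(v <- t) load v <= \sum_(v <- t) gain v + 5 ->
    3 * #|T| <= \sum_v deg v + 2 \/ exists2 v, poor v & v \notin t.
  move=> tu tl; case: (pickP [pred v | poor v && (v \notin t)]) => [v /andP[]|all_t].
    by right; exists v.
  left; apply: degree_sum_of_load tu _ tl => v vt.
  by have := all_t v; rewrite /= vt andbT => ->.
case: (done_or_poor [::]) => [||//|[v1 p1 _]] //; first by rewrite !big_nil.
have [t1 [x1 [u1 _]]] := poor_unit p1.
have l1 : \sum_(v <- t1) load v <= \sum_(v <- t1) gain v + 5.
  by apply: leq_trans (unit_load u1) _; rewrite leq_add2l.
case: (done_or_poor t1 (unit_uniq u1) l1) => [//|[v2 p2 v2t1]].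
have [t2 [x2 [u2 v2t2]]] := poor_unit p2.
have d12 : ~~ has (mem t1) t2 by rewrite has_sym (unit_disjoint u2 u1 v2t2 v2t1).
have [unq ld] := two_units_load u1 u2 d12.
case: (done_or_poor _ unq ld) => [//|[v3 p3]].
rewrite !in_cons mem_cat !negb_or => /and4P[_ _ v3t1 v3t2].
have [t3 [x3 [u3 v3t3]]] := poor_unit p3.
case: (no_three_pendants (unit_pendant u1) (unit_pendant u2) (unit_pendant u3)).
- exact: disjoint_seq.
- by rewrite disjoint_sym; apply/disjoint_seq/(unit_disjoint u3 u1 v3t3).
- by rewrite disjoint_sym; apply/disjoint_seq/(unit_disjoint u3 u2 v3t3).
- rewrite /= !inE.
  rewrite (unit_attach_notin u1 u1) (unit_attach_notin u1 u2) (unit_attach_notin u1 u3).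
  rewrite (unit_attach_notin u2 u1) (unit_attach_notin u2 u2) (unit_attach_notin u2 u3).
  by rewrite (unit_attach_notin u3 u1) (unit_attach_notin u3 u2) (unit_attach_notin u3 u3).
Qed.

End LocalStructure.

(** * Combining the three degree bounds *)

Theorem theorem9 (T : finType) (e : rel T) (n : nat) :
  simple_graph e -> maximal_nontraceable e -> #|T| = n ->
  [/\ n = 8 -> 10 <= nb_edges e,
      n = 9 -> 12 <= nb_edges e
    & 10 <= n -> ((3 * n%:R - 2) / 2 <= (nb_edges e)%:R :> rat)%R].
Proof.
move=> [esy eirr] mnt Tn.
have key : 7 < #|T| -> [|| 7 * #|T| <= 2 * nb_edges e + 32,
    4 * #|T| <= 2 * nb_edges e + 12 | 3 * #|T| <= 2 * nb_edges e + 2].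
  move=> T_gt7; rewrite -handshake //; apply/negPn/negP; rewrite !negb_or.
  case/and3P=> /negP disc /negP pend /negP[]; apply: degree_sum => //.
    move=> A Acl A0; apply/eqP/negPn/negP=> AT; apply: disc.
    exact: closed_set_degree Acl A0 AT.
  move=> A x tp; apply: pend; exact: three_pendants_degree tp.
rewrite Tn in key; split=> [n8|n9|n10].
- by rewrite n8 in key; lia.
- by rewrite n9 in key; lia.
(* From order 10 on, 4n - 12 and 7n - 32 are both at least 3n - 2. *)
- have {key} : 3 * n <= 2 * nb_edges e + 2 by lia.
  rewrite -(ler_nat rat) natrD !natrM => h.
  by rewrite ler_pdivrMr ?ltr0n // lerBlDr mulrC [(_ * 2)%R]mulrC mulrC.
Qed.
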